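(* There is a parsimonious reduction from $\textsc{P-Tromino}_{n,n/3}$ to $\textsc{MaxFlow}_{n/3}$ that is computable in linear time. Explicitly: there is an algorithm which, given an instance $(R,P)$ of $\textsc{P-Tromino}_{n,n/3}$ (a region $R$ with $n$ cells, $n$ a multiple of $3$, and a set $P$ of $n/3$ cells of $R$ carrying pegs), outputs in $O(n)$ time a flow network $G$ (with source $s$, sink $t$, and edge and vertex capacities) such that (i) the value of a maximum flow in $G$ equals $n/3$ if and only if $R$ with pegs $P$ has a p-cover, and (ii) the number of p-covers of $(R,P)$ equals the number of flows $f$ in $G$ with $|f| = n/3$.
   Context: A cell is a unit square $[a,a+1]\times[b,b+1]$ with $a,b\in\mathbb Z$. A region $R$ is a finite union of cells whose interior is connected. Two cells are adjacent if their Manhattan distance is $1$ (diagonal cells are not adjacent). A tromino is an L-shaped polyomino of three cells: a corner cell together with two cells (tips) adjacent to it, one horizontally and one vertically. Given a region $R$ and a set $P$ of cells of $R$ carrying pegs, a p-tromino is a tromino with a hole in its corner cell; it may be placed in $R$ only with its corner cell on a cell of $P$, and pegs may only be occupied by holes. A p-cover of $(R,P)$ is a set of p-trominoes contained in $R$, pairwise non-overlapping, covering all cells of $R$, each with its corner cell on a peg cell and its tips on peg-free cells. $\textsc{P-Tromino}_{n,k}$: given a region $R$ with $n$ cells and a list $P$ of $k$ peg cells, decide whether a p-cover exists. A flow network is a directed graph (no self-loops, no pair of antiparallel edges) with capacities $c(u,v)\ge 0$ on edges and $c(v)\ge 0$ on vertices, a source $s$ with in-degree $0$ and a sink $t$ with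 out-degree $0$. A flow is a function $f:E\to\mathbb N$ with $0\le f(u,v)\le c(u,v)$ on every edge, total flow entering each vertex $v$ at most $c(v)$, and flow conservation at every vertex other than $s,t$; its value is $|f|=\sum_v f(s,v)$. $\textsc{MaxFlow}_k$: given a flow network $G$ and positive integer $k$, decide whether the maximum flow value in $G$ equals $k$. A reduction is parsimonious if it preserves the number of certificates (here: number of p-covers equals number of flows of value $n/3$ in the output network). *)

(* Defs.v *)
From HB Require Import structures.
From mathcomp Require Import all_boot all_order all_algebra.
From mathcomp Require Import all_classical all_reals topology.
From mathcomp Require Import Rstruct Rstruct_topology.

Set Implicit Arguments.
Unset Strict Implicit.
Unset Printing Implicit Defensive.
Import Order.TTheory GRing.Theory Num.Theory.

Local Open Scope ring_scope.
Local Open Scope classical_set_scope.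

Definition cell : Type := (int * int)%type.

Definition square (c : cell) : set (Rdefinitions.R * Rdefinitions.R) :=
  [set z | c.1%:~R <= z.1 <= c.1%:~R + 1 /\ c.2%:~R <= z.2 <= c.2%:~R + 1].

Definition plane_region (cells : seq cell) :
    set (Rdefinitions.R * Rdefinitions.R) :=
  \bigcup_(c in [set` cells]) square c.

(* A region is listed by its cells.  The empty set, which is [connected] in the
   sense of the library, is not a region: MaxFlow_k is posed for k > 0. *)
Definition is_region (cells : seq cell) : Prop :=
  [/\ cells != [::], uniq cells & connected (interior (plane_region cells))].

Definition manhattan (c d : cell) : int := `|c.1 - d.1| + `|c.2 - d.2|.

Definition adjacent (c d : cell) : bool := manhattan c d == 1.

Record tromino := Tromino { corner : cell; htip : cell; vtip : cell }.

Definition is_tromino (t : tromino) : bool :=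
  [&& adjacent (corner t) (htip t), (htip t).2 == (corner t).2,
      adjacent (corner t) (vtip t) & (vtip t).1 == (corner t).1].

Definition tromino_cells (t : tromino) : seq cell :=
  [:: corner t; htip t; vtip t].

Definition is_ptromino (R P : seq cell) (t : tromino) : Prop :=
  [/\ is_tromino t, {subset tromino_cells t <= R}, corner t \in P,
      htip t \notin P & vtip t \notin P].

Definition is_pcover (R P : seq cell) (T : set tromino) : Prop :=
  [/\ forall t, T t -> is_ptromino R P t,
      forall t u c, T t -> T u -> c \in tromino_cells t ->
        c \in tromino_cells u -> t = u
    & forall c, c \in R -> exists2 t, T t & c \in tromino_cells t].

Definition ptromino_instance (n k : nat) (R P : seq cell) : Prop :=
  [/\ is_region R, size R = n, uniq P, {subset P <= R} & size P = k].

Record network := Network {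
  nvertices : nat;
  edges : {set 'I_nvertices * 'I_nvertices};
  ecap : 'I_nvertices -> 'I_nvertices -> nat;  (* only relevant on [edges] *)
  vcap : 'I_nvertices -> nat;
  src : 'I_nvertices;
  snk : 'I_nvertices }.

Definition is_flow_network (G : network) : Prop :=
  [/\ forall u, (u, u) \notin edges G,
      forall u v, (u, v) \in edges G -> (v, u) \notin edges G,
      forall u, (u, src G) \notin edges G,
      forall v, (snk G, v) \notin edges G
    & src G != snk G].

Definition edge (G : network) :=
  {e : 'I_(nvertices G) * 'I_(nvertices G) | e \in edges G}.

Definition inflow (G : network) (f : {ffun edge G -> nat})
    (v : 'I_(nvertices G)) : nat :=
  (\sum_(e : edge G | (val e).2 == v) f e)%N.

Definition outflow (G : network) (f : {ffun edge G -> nat})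
    (v : 'I_(nvertices G)) : nat :=
  (\sum_(e : edge G | (val e).1 == v) f e)%N.

Definition is_flow (G : network) (f : {ffun edge G -> nat}) : Prop :=
  [/\ forall e : edge G, (f e <= ecap (val e).1 (val e).2)%N,
      forall v, (inflow f v <= vcap v)%N
    & forall v, v != src G -> v != snk G -> inflow f v = outflow f v].

Definition flow_value (G : network) (f : {ffun edge G -> nat}) : nat :=
  outflow f (src G).

Definition max_flow_value (G : network) (k : nat) : Prop :=
  (exists2 f : {ffun edge G -> nat}, is_flow f & flow_value f = k) /\
  (forall f : {ffun edge G -> nat}, is_flow f -> (flow_value f <= k)%N).

(* The unit-cost RAM of Cook and Reckhow ("Time bounded random access machines",
   1973): integer registers X_0, X_1, ... initially 0, addition and subtraction
   as the only arithmetic, indirect addressing, a sequential input tape and a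
   sequential output tape, and an explicit halting instruction. *)
Inductive instr :=
| Const of nat & int
| Plus of nat & nat & nat
| Minus of nat & nat & nat
| Fetch of nat & nat
| Store of nat & nat
| JumpPos of nat & nat
| Read of nat
| Print of nat
| Halt.

Record state := State {
  pc : nat;
  regs : nat -> int;
  input : seq int;
  output : seq int }.

Definition upd (m : nat -> int) (a : nat) (x : int) : nat -> int :=
  fun b => if b == a then x else m b.

(* [None] when the machine is halted or faults: negative address, exhausted
   input, or no instruction at line [pc]. *)
Definition step (p : seq instr) (s : state) : option state :=
  let: State l m inp out := s in
  match onth p l with
  | Some (Const i c) => Some (State l.+1 (upd m i c) inp out)
  | Some (Plus i j k) => Some (State l.+1 (upd m i (m j + m k)) inp out)
  | Some (Minus i j k) => Some (State l.+1 (upd m i (m j - m k)) inp out)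
  | Some (Fetch i j) =>
      if m j is Posz a then Some (State l.+1 (upd m i (m a)) inp out) else None
  | Some (Store i j) =>
      if m i is Posz a then Some (State l.+1 (upd m a (m j)) inp out) else None
  | Some (JumpPos l' j) => Some (State (if 0 < m j then l' else l.+1) m inp out)
  | Some (Read i) =>
      if inp is x :: inp' then Some (State l.+1 (upd m i x) inp' out) else None
  | Some (Print i) => Some (State l.+1 m inp (rcons out (m i)))
  | Some Halt | None => None
  end.

Definition steps (p : seq instr) (t : nat) (s : state) : option state :=
  iter t (obind (step p)) (Some s).

Definition init (inp : seq int) : state := State 0 (fun=> 0) inp [::].

Definition computes_within (p : seq instr) (t : nat) (inp out : seq int) : Prop :=
  exists (t' : nat) (s : state),
    [/\ (t' <= t)%N, steps p t' (init inp) = Some s,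
        onth p (pc s) = Some Halt & output s = out].

Definition encode_cells (s : seq cell) : seq int :=
  flatten [seq [:: c.1; c.2] | c <- s].

Definition encode_instance (R P : seq cell) : seq int :=
  [:: (size R)%:Z, (size P)%:Z & encode_cells R ++ encode_cells P].

Definition encode_edge (G : network) (e : 'I_(nvertices G) * 'I_(nvertices G)) :
  seq int := [:: (e.1 : nat)%:Z; (e.2 : nat)%:Z; (ecap e.1 e.2)%:Z].

(* Vertices are numbered from 0; the edges may be listed in any order. *)
Definition encodes_network (G : network) (w : seq int) : Prop :=
  exists2 es : seq ('I_(nvertices G) * 'I_(nvertices G)),
      uniq es /\ es =i edges G &
    w = [:: (nvertices G)%:Z, (size es)%:Z, (src G)%:Z, (snk G)%:Z
          & [seq (vcap v)%:Z | v <- enum 'I_(nvertices G)] ++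
            flatten [seq encode_edge e | e <- es]].

(* Main.v *)
Require Import Defs.
From mathcomp Require Import all_boot all_order all_algebra.
From mathcomp Require Import all_classical.
From mathcomp Require Import all_reals topology normedtype.
From mathcomp Require Import Rstruct Rstruct_topology.
From mathcomp Require Import zify lra.

(** Call a cell even or odd according to the parity of its column.  One tip of a
    tromino lies in the column of its corner and the other in an adjacent column,
    so exactly one tip is even.  Route unit flows from the source through an even
    free cell, then a peg, then an odd free cell, to the sink, every edge, cell and
    peg having capacity 1: a flow of value n/3 saturates every peg, hence gives it
    one horizontal and one vertical tip, and the cell capacities make the tips
    distinct; by counting, the tips then exhaust the free cells.

    Adjacent cells are found in linear time by a table indexed by coordinates.
    Connectedness bounds the extent of the region by n, so that a table with rows
    of width 2n+1 suffices; it is never initialised, because the registers of the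
    machine start at 0, and the multiples of its width are precomputed by
    additions, because the machine cannot multiply. *)

Set Implicit Arguments.
Unset Strict Implicit.
Unset Printing Implicit Defensive.
Import Order.TTheory GRing.Theory Num.Theory.
Import numFieldNormedType.Exports.

(** * Extent of a region *)

(** Covers and flows of value k are never compared directly. Both are matched with one finite set:
    the functions that give every peg and axis a sign, called [valid] when the resulting tips are
    distinct free cells. Each matching is the restriction of a map that is injective on all such
    functions, so the two counts are the number of valid ones. Column parity gives every free cell a
    single role, before the pegs or after them, whichever axis it is reached along. One unit
    capacity thus keeps both horizontal and vertical tips of different trominoes off the same cell.
    The output tape is sequential and the edge count comes first, before any adjacency is known.
    Hence every peg receives exactly four edges, real or blind. Parity, which the machine cannot
    test, is read from a table of alternating bits. The program is written in a small structured
    language with time-bounded Hoare triples, so that jumps and line numbers are dealt with once. *)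

Section Extent.
Local Open Scope ring_scope.
Local Open Scope classical_set_scope.

Local Notation RR := Rdefinitions.R.

Let center (c : cell) : RR * RR := (c.1%:~R + 2^-1, c.2%:~R + 2^-1).

Lemma center_interior (cells : seq cell) (c : cell) :
  c \in cells -> interior (plane_region cells) (center c).
Proof.
move=> cin; rewrite /interior /=.
exists (ball (c.1%:~R + 2^-1 : RR) 2^-1, ball (c.2%:~R + 2^-1 : RR) 2^-1).
  by split; apply: nbhsx_ballx; rewrite invr_gt0.
move=> [u v] [/=]; rewrite /ball/= => hu hv; exists c => //; rewrite /square/=.
move: hu hv; rewrite !ltr_distlC => /andP[? ?] /andP[? ?].
by split; apply/andP; split; lra.
Qed.

(** [pr] and [co] stand for either coordinate, on points and on cells, so that columns and rows
    share one argument. *)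
Variables (cells : seq cell) (pr : RR * RR -> RR) (co : cell -> int).
Hypothesis pr_cont : continuous pr.
Hypothesis pr_square : forall c z, square c z -> (co c)%:~R <= pr z <= (co c)%:~R + 1.
Hypothesis pr_center : forall c, pr (center c) = (co c)%:~R + 2^-1.

(* The projection of the connected interior is an interval, and only cells of column
   a project onto a + 1/2. *)
Lemma coordinate_interval (c d : cell) (a : int) :
  connected (interior (plane_region cells)) -> c \in cells -> d \in cells ->
  co c <= a <= co d -> a \in map co cells.
Proof.
move=> conn cin din /andP[ca ad].
have := @connected_continuous_connected _ _ _ pr conn.
have prc : {within interior (plane_region cells), continuous pr}.
  exact: continuous_subspaceT.
move=> /(_ prc) /connected_intervalP itv.
have imc e : e \in cells -> (pr @` interior (plane_region cells)) (pr (center e)).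
  by move=> ein; exists (center e) => //; exact: center_interior.
have [|z zint prz] := itv _ _ (imc _ cin) (imc _ din) (a%:~R + 2^-1).
  by rewrite !pr_center !lerD2r !ler_int ca ad.
have [c' c'in] := interior_subset zint.
move=> /pr_square; rewrite prz => /andP[h1 h2].
apply/mapP; exists c' => //.
have h3 : (co c')%:~R < (a + 1)%:~R :> RR by rewrite intrD; lra.
have h4 : a%:~R < (co c' + 1)%:~R :> RR by rewrite intrD; lra.
rewrite !ltr_int in h3 h4; lia.
Qed.

(** Pigeonhole: every integer between the two coordinates is the coordinate of some cell, so there
    are at most as many of them as cells. *)
Lemma coordinate_extent (c d : cell) :
  connected (interior (plane_region cells)) -> c \in cells -> d \in cells ->
  `|co c - co d| < (size cells)%:Z.
Proof.
move=> conn.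
suff ext c' d' : c' \in cells -> d' \in cells -> co c' <= co d' ->
    co d' - co c' < (size cells)%:Z.
  move=> cin din; case: (leP (co c) (co d)) => cd.
    by have := ext _ _ cin din cd; lia.
  by have := ext _ _ din cin (ltW cd); lia.
move=> cin din cd; set m := `|co d' - co c'|%N.
have mE : co d' - co c' = m%:Z by rewrite /m; lia.
rewrite mE ltz_nat -(size_map co) -(size_iota 0 m.+1) -(size_map (fun i : nat => co c' + i%:Z)).
apply: uniq_leq_size.
  by rewrite map_inj_uniq ?iota_uniq // => i j; lia.
move=> _ /mapP[i + ->]; rewrite mem_iota => /andP[_ im].
by apply: (coordinate_interval conn cin din); lia.
Qed.

End Extent.

Section RegionExtent.
Local Open Scope ring_scope.

Lemma region_extent (cells : seq cell) (c d : cell) :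
  is_region cells -> c \in cells -> d \in cells ->
  `|c.1 - d.1| < (size cells)%:Z /\ `|c.2 - d.2| < (size cells)%:Z.
Proof.
move=> [_ _ conn] cin din; split.
- apply: (@coordinate_extent cells fst fst) => //.
  + by move=> z; exact: cvg_fst.
  + by move=> ? ? [].
- apply: (@coordinate_extent cells snd snd) => //.
  + by move=> z; exact: cvg_snd.
  + by move=> ? ? [].
Qed.
End RegionExtent.

(** * A program logic for the RAM *)

Section StructuredRAM.
Local Open Scope ring_scope.

(** Both control structures branch on a positive register, the only test of the machine:
    [Unless r c] skips [c] when [r] is positive, and [Repeat c r] tests after the body, so a loop
    makes at least one round. *)
Inductive cmd :=
| Do of instr
| Seq of cmd & cmd
| Unless of nat & cmd
| Repeat of cmd & nat.

Fixpoint csize (c : cmd) : nat :=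
  match c with
  | Do _ => 1
  | Seq c1 c2 => csize c1 + csize c2
  | Unless _ c => (csize c).+1
  | Repeat c _ => (csize c).+1
  end.

(** Jump targets are absolute, hence the starting line [l] as a parameter. *)
Fixpoint compile (l : nat) (c : cmd) : seq instr :=
  match c with
  | Do i => [:: i]
  | Seq c1 c2 => compile l c1 ++ compile (l + csize c1) c2
  | Unless r c => JumpPos (l + (csize c).+1) r :: compile l.+1 c
  | Repeat c r => rcons (compile l c) (JumpPos l r)
  end.

Lemma size_compile l c : size (compile l c) = csize c.
Proof.
elim: c l => //= [c1 IH1 c2 IH2|r c IH|c IH r] l.
- by rewrite size_cat IH1 IH2.
- by rewrite IH.
- by rewrite size_rcons IH.
Qed.

(* The machine memory is split into 32 scalar registers and a heap, so that a
   store at a computed address never aliases a scalar. *)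
Record conf := Conf {
  scal : nat -> int;
  heap : int -> int;
  tin : seq int;
  tout : seq int }.

Definition memory (s : conf) : nat -> int :=
  fun a => if (a < 32)%N then scal s a else heap s a.

(** Written with [eqn] rather than [==] so that [cbn] decides lookups at literal register
    numbers. *)
Definition setr (m : nat -> int) (a : nat) (x : int) : nat -> int :=
  fun b => if eqn b a then x else m b.

Definition seth (h : int -> int) (a x : int) : int -> int :=
  fun b => if b == a then x else h b.

Definition at_line (l : nat) (s : conf) (st : state) : Prop :=
  [/\ pc st = l, regs st =1 memory s, input st = tin s & output st = tout s].

(** Quantifying over the surrounding code makes executions composable. *)
Definition runs (c : cmd) (s : conf) (t : nat) (s' : conf) : Prop :=
  forall pre post st, at_line (size pre) s st ->
  exists2 st', steps (pre ++ compile (size pre) c ++ post) t st = Some st' &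
    at_line (size pre + csize c) s' st'.

Lemma steps_add p t1 t2 st : steps p (t1 + t2) st = obind (steps p t2) (steps p t1 st).
Proof.
rewrite /steps addnC iterD; case: (iter t1 _ _) => //=.
by elim: t2 => //= t2 ->.
Qed.

Lemma onth_cat_size (T : Type) (s1 s2 : seq T) : onth (s1 ++ s2) (size s1) = ohead s2.
Proof. by elim: s1 => //=; case: s2. Qed.

Lemma runs_seq c1 c2 s1 t1 s2 t2 s3 :
  runs c1 s1 t1 s2 -> runs c2 s2 t2 s3 -> runs (Seq c1 c2) s1 (t1 + t2) s3.
Proof.
move=> r1 r2 pre post st at1; rewrite /= -catA.
have [st2 e2 at2] := r1 pre (compile (size pre + csize c1) c2 ++ post) st at1.
have szE : size (pre ++ compile (size pre) c1) = (size pre + csize c1)%N.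
  by rewrite size_cat size_compile.
have := r2 (pre ++ compile (size pre) c1) post st2.
rewrite szE -catA => /(_ at2) [st3 e3 at3].
by exists st3; [rewrite steps_add e2|rewrite addnA].
Qed.

Lemma runs_unless_skip r c s : 0 < scal s r -> (r < 32)%N -> runs (Unless r c) s 1 s.
Proof.
move=> rpos rlt pre post [l m i o] [/= -> mE iE oE].
rewrite /steps /= onth_cat_size /= mE /memory rlt rpos.
by eexists; first by [].
Qed.

Lemma runs_unless_do r c s t s' :
  ~~ (0 < scal s r) -> (r < 32)%N -> runs c s t s' -> runs (Unless r c) s t.+1 s'.
Proof.
move=> rpos rlt rc pre post [l m i o] [+ + iE oE]; rewrite [pc _]/= [regs _]/= => -> mE.
have := rc (rcons pre (JumpPos (size pre + (csize c).+1) r)) post (State (size pre).+1 m i o).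
rewrite size_rcons => -[//|st' e' at'].
exists st'; last by rewrite addnS.
rewrite -(add1n t) steps_add /steps /= onth_cat_size /= mE /memory rlt (negbTE rpos) /=.
by rewrite cat_rcons in e'.
Qed.

Lemma runs_repeat_stop c r s t s' :
  runs c s t s' -> (r < 32)%N -> ~~ (0 < scal s' r) -> runs (Repeat c r) s t.+1 s'.
Proof.
move=> rc rlt rpos pre post st at1; rewrite [compile _ _]/= cat_rcons.
have [[l m i o] e' at'] := rc pre (JumpPos (size pre) r :: post) st at1.
rewrite -(addn1 t) steps_add e' [obind _ _]/=; case: at' => /= -> mE iE oE.
rewrite /steps /= catA -(size_compile (size pre) c) -size_cat onth_cat_size /= mE /memory rlt
  (negbTE rpos).
by eexists; first by []; split=> //=; rewrite addnS size_cat.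
Qed.

Lemma runs_repeat_loop c r s t s' t' s'' :
  runs c s t s' -> (r < 32)%N -> 0 < scal s' r -> runs (Repeat c r) s' t' s'' ->
  runs (Repeat c r) s (t.+1 + t') s''.
Proof.
move=> rc rlt rpos rl pre post st at1.
have [[l m i o] e' at'] := rc pre (JumpPos (size pre) r :: post) st at1.
have [|st'' e'' at''] := rl pre post (State (size pre) m i o); first by case: at'.
exists st'' => //; rewrite steps_add -e''.
rewrite [compile _ _]/= cat_rcons -(addn1 t) steps_add e' [obind _ _]/=.
case: at' => /= -> mE iE oE.
rewrite /steps /= {2}catA -(size_compile (size pre) c) -size_cat onth_cat_size /= mE /memory
  rlt rpos.
by [].
Qed.

(** The value at [Repeat] is a dummy: [wp] is false there, and loops are charged by
    [hoare_repeat]. *)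
Fixpoint loopfree_cost (c : cmd) : nat :=
  match c with
  | Do _ => 1
  | Seq c1 c2 => loopfree_cost c1 + loopfree_cost c2
  | Unless _ c => (loopfree_cost c).+1
  | Repeat c _ => 0
  end.

(** Addresses computed at run time must be at least 32, which keeps them off the scalar registers.
    Raw jumps and [Halt] are rejected, since control flow comes from the structured commands
    alone. *)
Fixpoint wp (c : cmd) (Q : conf -> Prop) (s : conf) : Prop :=
  match c with
  | Do (Const i x) =>
      (i < 32)%N /\ Q (Conf (setr (scal s) i x) (heap s) (tin s) (tout s))
  | Do (Plus i j k) => [&& i < 32, j < 32 & k < 32]%N /\
      Q (Conf (setr (scal s) i (scal s j + scal s k)) (heap s) (tin s) (tout s))
  | Do (Minus i j k) => [&& i < 32, j < 32 & k < 32]%N /\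
      Q (Conf (setr (scal s) i (scal s j - scal s k)) (heap s) (tin s) (tout s))
  | Do (Fetch i j) => [/\ (i < 32)%N, (j < 32)%N, 32 <= scal s j &
      Q (Conf (setr (scal s) i (heap s (scal s j))) (heap s) (tin s) (tout s))]
  | Do (Store i j) => [/\ (i < 32)%N, (j < 32)%N, 32 <= scal s i &
      Q (Conf (scal s) (seth (heap s) (scal s i) (scal s j)) (tin s) (tout s))]
  | Do (Read i) => (i < 32)%N /\
      if tin s is x :: inp then Q (Conf (setr (scal s) i x) (heap s) inp (tout s))
      else False
  | Do (Print i) => (i < 32)%N /\
      Q (Conf (scal s) (heap s) (tin s) (rcons (tout s) (scal s i)))
  | Do _ => False
  | Seq c1 c2 => wp c1 (wp c2 Q) s
  | Unless r c => (r < 32)%N /\ if 0 < scal s r then Q s else wp c Q s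
  | Repeat _ _ => False
  end.

Lemma wp_seq c1 c2 Q s : wp c1 (wp c2 Q) s -> wp (Seq c1 c2) Q s.
Proof. by []. Qed.

(** The rules name addresses and results by equations, so that a state can be displayed with
    arithmetic values instead of nested register lookups. *)
Section StepRules.
Variables (Q : conf -> Prop) (m : nat -> int) (h : int -> int) (inp out : seq int).
Local Notation st := (Conf m h inp out).

Lemma wp_const i x : (i < 32)%N -> Q (Conf (setr m i x) h inp out) -> wp (Do (Const i x)) Q st.
Proof. by []. Qed.

Lemma wp_plus i j l x : [&& i < 32, j < 32 & l < 32]%N -> m j + m l = x ->
  Q (Conf (setr m i x) h inp out) -> wp (Do (Plus i j l)) Q st.
Proof. by move=> ijl <-. Qed.

Lemma wp_minus i j l x : [&& i < 32, j < 32 & l < 32]%N -> m j - m l = x ->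
  Q (Conf (setr m i x) h inp out) -> wp (Do (Minus i j l)) Q st.
Proof. by move=> ijl <-. Qed.

Lemma wp_fetch i j a x : (i < 32)%N && (j < 32)%N -> m j = a -> 32 <= a -> h a = x ->
  Q (Conf (setr m i x) h inp out) -> wp (Do (Fetch i j)) Q st.
Proof. by case/andP=> ilt jlt <- ? <-. Qed.

Lemma wp_store i j a x : (i < 32)%N && (j < 32)%N -> m i = a -> 32 <= a -> m j = x ->
  Q (Conf m (seth h a x) inp out) -> wp (Do (Store i j)) Q st.
Proof. by case/andP=> ilt jlt <- ? <-. Qed.

Lemma wp_read i x inp' : (i < 32)%N -> inp = x :: inp' ->
  Q (Conf (setr m i x) h inp' out) -> wp (Do (Read i)) Q st.
Proof. by move=> ilt -> q. Qed.

Lemma wp_print i x : (i < 32)%N -> m i = x ->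
  Q (Conf m h inp (rcons out x)) -> wp (Do (Print i)) Q st.
Proof. by move=> ilt <-. Qed.

Lemma wp_unless_skip r c : (r < 32)%N -> 0 < m r -> Q st -> wp (Unless r c) Q st.
Proof. by move=> rlt pos q; split; rewrite //= pos. Qed.

Lemma wp_unless_do r c : (r < 32)%N -> m r <= 0 -> wp c Q st -> wp (Unless r c) Q st.
Proof. by move=> rlt npos q; split; rewrite //= ltNge npos. Qed.
End StepRules.

Definition hoare (T : nat) (A : conf -> Prop) (c : cmd) (B : conf -> Prop) : Prop :=
  forall s, A s -> exists t s', [/\ (t <= T)%N, runs c s t s' & B s'].

Lemma upd_memory m s i x inp out : m =1 memory s -> (i < 32)%N ->
  upd m i x =1 memory (Conf (setr (scal s) i x) (heap s) inp out).
Proof.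
move=> mE ilt b; rewrite /upd mE /memory /setr /= -[eqn b i]/(b == i).
by case: eqP => // ->; rewrite ilt.
Qed.

Lemma wp_step (i : instr) Q s : wp (Do i) Q s ->
  exists2 s', Q s' & forall pre post st, at_line (size pre) s st ->
    exists2 st', step (pre ++ i :: post) st = Some st' & at_line (size pre).+1 s' st'.
Proof.
case: i => [i x|i j k|i j k|i j|i j|l' j|i|i|] //=.
- case=> ilt q; eexists; first exact: q.
  move=> pre post [_ m _ _] [/= -> mE -> ->].
  rewrite onth_cat_size /=; eexists; first by [].
  by split=> //=; exact: upd_memory.
- case=> /and3P[ilt jlt klt] q; eexists; first exact: q.
  move=> pre post [_ m _ _] [/= -> mE -> ->].
  rewrite onth_cat_size /= !mE /memory jlt klt; eexists; first by [].
  by split=> //=; exact: upd_memory.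
- case=> /and3P[ilt jlt klt] q; eexists; first exact: q.
  move=> pre post [_ m _ _] [/= -> mE -> ->].
  rewrite onth_cat_size /= !mE /memory jlt klt; eexists; first by [].
  by split=> //=; exact: upd_memory.
- case=> ilt jlt jge q; eexists; first exact: q.
  move=> pre post [_ m _ _] [/= -> mE -> ->].
  rewrite onth_cat_size /= mE {1}/memory jlt.
  case: (scal s j) jge => // a; rewrite lez_nat => age.
  rewrite mE /memory ltnNge age /=; eexists; first by [].
  by split=> //=; exact: upd_memory.
- case=> ilt jlt ige q; eexists; first exact: q.
  move=> pre post [_ m _ _] [/= -> mE -> ->].
  rewrite onth_cat_size /= mE {1}/memory ilt.
  case: (scal s i) ige => // a; rewrite lez_nat => age.
  eexists; first by [].
  split=> //= b; rewrite /upd !mE /memory jlt /= /seth eqz_nat.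
  by case: eqP => // ->; rewrite ltnNge age.
- case=> ilt; case sE: (tin s) => [//|x inp] q; eexists; first exact: q.
  move=> pre post [_ m _ _] [/= -> mE -> ->].
  rewrite onth_cat_size /= sE; eexists; first by [].
  by split=> //=; exact: upd_memory.
- case=> ilt q; eexists; first exact: q.
  move=> pre post [_ m _ _] [/= -> mE -> ->].
  rewrite onth_cat_size /=; eexists; first by [].
  by split=> //=; rewrite mE /memory ilt.
Qed.

Lemma wp_sound c Q s : wp c Q s ->
  exists t s', [/\ (t <= loopfree_cost c)%N, runs c s t s' & Q s'].
Proof.
elim: c Q s => [i|c1 IH1 c2 IH2|r c IH|//] Q s.
- case/wp_step=> s' q r; exists 1, s'; split=> // pre post st /(r pre post)[st' e at'].
  by exists st'; rewrite ?addn1 // /steps /= e.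
- case/IH1=> t1 [s1 [le1 r1 /IH2[t2 [s2 [le2 r2 q]]]]].
  exists (t1 + t2)%N, s2; split=> //; first exact: leq_add.
  exact: runs_seq r1 r2.
- case=> rlt; case: ifPn => [pos q|npos /IH[t [s' [le r' q]]]].
    by exists 1, s; split=> //; exact: runs_unless_skip.
  by exists t.+1, s'; split=> //; exact: runs_unless_do.
Qed.

Lemma hoare_wp c (A B : conf -> Prop) :
  (forall s, A s -> wp c B s) -> hoare (loopfree_cost c) A c B.
Proof. by move=> AB s /AB /wp_sound. Qed.

Lemma hoare_seq T1 T2 (A B C : conf -> Prop) c1 c2 :
  hoare T1 A c1 B -> hoare T2 B c2 C -> hoare (T1 + T2) A (Seq c1 c2) C.
Proof.
move=> h1 h2 s /h1[t1 [s1 [le1 r1 /h2[t2 [s2 [le2 r2 q]]]]]].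
exists (t1 + t2)%N, s2; split=> //; first exact: leq_add.
exact: runs_seq r1 r2.
Qed.

(** [J i] holds after [i] rounds. Tying the sign of the counter to [i.+1 < N] stops the loop after
    exactly [N] rounds; the extra unit per round pays for the closing jump. *)
Lemma hoare_repeat T N (J : nat -> conf -> Prop) c r : (r < 32)%N -> (0 < N)%N ->
  (forall i, (i < N)%N ->
    hoare T (J i) c (fun s => J i.+1 s /\ (0 < scal s r) = (i.+1 < N)%N)) ->
  hoare (N * T.+1) (J 0%N) (Repeat c r) (J N).
Proof.
move=> rlt Npos body.
suff loop d i : (i + d.+1 = N)%N -> hoare (d.+1 * T.+1) (J i) (Repeat c r) (J N).
  by case: N Npos loop {body} => // N _ loop; exact: loop.
elim: d i => [|d IH] i iN s Js.
  have [|t [s' [le rc [Js' pos]]]] := body i _ s Js; first by lia.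
  exists t.+1, s'; split; [by rewrite mul1n| |by rewrite -iN addn1].
  by apply: runs_repeat_stop => //; rewrite pos -iN addn1 ltnn.
have [|t [s' [le rc [Js' pos]]]] := body i _ s Js; first by lia.
have [|t' [s'' [le' rc' Js'']]] := IH i.+1 _ s' Js'; first by lia.
exists (t.+1 + t')%N, s''; split=> //; first by rewrite mulSn; lia.
by apply: runs_repeat_loop rc' => //; rewrite pos; lia.
Qed.

Lemma hoare_computes T c inp out :
  hoare T (eq (Conf (fun=> 0) (fun=> 0) inp [::])) c (fun s => tout s = out) ->
  computes_within (rcons (compile 0 c) Halt) T inp out.
Proof.
move=> /(_ _ erefl) [t [s' [le r outE]]].
have [|st' e [pcE _ _ oE]] := r [::] [:: Halt] (init inp).
  by split=> // a; rewrite /memory /=; case: ifP.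
exists t, st'; split=> //.
- by rewrite -cats1.
- by rewrite pcE add0n -(size_compile 0) -cats1 onth_cat_size.
- by rewrite oE.
Qed.

End StructuredRAM.

(** * The network *)

Section Directions.
Local Open Scope ring_scope.

Definition neighbor (c : cell) (d : bool * bool) : cell :=
  let s := if d.2 then 1 else -1 in
  if d.1 then (c.1 + s, c.2) else (c.1, c.2 + s).

(** With the offset that makes coordinates nonnegative, this is the parity of a table index, which
    the machine can look up. *)
Definition even_column (o : int) (c : cell) : bool := ~~ odd `|(c.1 + o)%R|%N.

Lemma even_column_neighbor o c d :
  even_column o (neighbor c d) = even_column o c (+) d.1.
Proof.
case: c d => x y [[] []]; rewrite /even_column /neighbor /= ?addbF //.
- by rewrite addbT; congr (~~ _); lia.
- by rewrite addbT; congr (~~ _); lia.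
Qed.

Lemma neighbor_inj c : injective (neighbor c).
Proof.
case: c => x y [[] []] [[] []]; rewrite /neighbor //= => -[] *; exfalso; lia.
Qed.

Definition tromino_at (c : cell) (h v : bool) : tromino :=
  Tromino c (neighbor c (true, h)) (neighbor c (false, v)).

Lemma is_tromino_at c h v : is_tromino (tromino_at c h v).
Proof.
case: c => x y; apply/and4P; split; rewrite /adjacent /manhattan /=.
- by case: h; lia.
- by [].
- by case: v; lia.
- by [].
Qed.

Lemma is_trominoP t : is_tromino t -> exists h v, t = tromino_at (corner t) h v.
Proof.
case: t => [[x y] [hx hy] [vx vy]] /and4P[/=]; rewrite /adjacent /manhattan /=.
move=> h1 /eqP h2 v1 /eqP v2; exists (hx == x + 1), (vy == y + 1).
rewrite /tromino_at /neighbor /=; congr Tromino; congr pair => //.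
- by case: eqP => //; lia.
- by case: eqP => //; lia.
Qed.

End Directions.

(** * The layered network of a peg instance and its encoding *)

Section FlowNetwork.
Variables (R P : seq cell) (o : int).
Let n := size R.
Let k := size P.

Definition free_cell (q : cell) : bool := (q \in R) && (q \notin P).

Definition direction_rank (d : bool * bool) : nat := (~~ d.1).*2 + ~~ d.2.

Definition cell_at (s : seq cell) (i : nat) : cell := nth (0%R, 0%R) s i.

(* Vertex 0 is the source and 1 the sink; then come the cells of R, the pegs, and
   for every peg and direction a dead end that absorbs the edge to a neighbour
   that is not a free cell, so that the number of edges depends on n and k only. *)
Definition spoke (i : nat) : nat * nat :=
  if even_column o (cell_at R i) then (0, i + 2) else (i + 2, 1).

(** Each blind slot has its own dead end: with a shared one, two blind slots of a peg would be the
    same edge and the edge count would drop. *)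
Definition slot (j : nat) (d : bool * bool) : nat * nat :=
  let q := neighbor (cell_at P j) d in
  let p := n + 2 + j in
  if free_cell q then
    if even_column o q then (index q R + 2, p) else (p, index q R + 2)
  else (p, n + 2 + k + 4 * j + direction_rank d).

Definition directions : seq (bool * bool) :=
  [:: (true, true); (true, false); (false, true); (false, false)].

Definition edge_list : seq (nat * nat) :=
  [seq spoke i | i <- iota 0 n] ++ [seq slot j d | j <- iota 0 k, d <- directions].

Local Notation edge_index := ('I_n + 'I_k * (bool * bool))%type.

(** Indexing the edges by a sum type lets sums over edges split into spokes and slots. *)
Definition ends (e : edge_index) : nat * nat :=
  match e with inl i => spoke i | inr y => slot y.1 y.2 end.

Let last_vertex := n + 5 * k + 1.
Let vertex (m : nat) : 'I_last_vertex.+1 := inord m.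
Definition vends (e : edge_index) := (vertex (ends e).1, vertex (ends e).2).

(** Capacity n at the source and the sink never binds, as at most n unit spokes meet there. *)
Definition peg_network : network :=
  @Network last_vertex.+1 [set e in codom vends]%SET (fun _ _ => 1)
    (fun v => if v < 2 then n else 1) (vertex 0) (vertex 1).

Hypotheses (uR : uniq R) (uP : uniq P) (PR : {subset P <= R}).

Lemma cell_at_mem (s : seq cell) i : i < size s -> cell_at s i \in s.
Proof. exact: mem_nth. Qed.

Lemma free_index q : free_cell q -> index q R < n.
Proof. by case/andP => qR _; rewrite index_mem. Qed.

Lemma direction_rank_lt d : direction_rank d < 4.
Proof. by case: d => [[] []]. Qed.

Lemma direction_rank_inj : injective direction_rank.
Proof. by move=> [[] []] [[] []]. Qed.

Lemma index_free_eq q i : free_cell q -> i < n -> (index q R == i) = (q == cell_at R i).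
Proof.
move=> /andP[qR _] ilt; apply/eqP/eqP => [<-|->].
  by rewrite /cell_at nth_index.
by rewrite /cell_at index_uniq.
Qed.

(* Every edge raises the level, which excludes loops and antiparallel edges. *)
Definition level (m : nat) : nat :=
  if m == 0 then 0 else if m == 1 then 4
  else if m < n + 2 then (if even_column o (cell_at R (m - 2)) then 1 else 3)
  else if m < n + 2 + k then 2 else 3.

Lemma level_ends e : level (ends e).1 < level (ends e).2.
Proof.
have lev_cell i : i < n -> level (i + 2) = if even_column o (cell_at R i) then 1 else 3.
  by move=> ilt; rewrite /level addnK ltn_add2r ilt; do 2 (case: eqP; first by lia).
have lev_peg j : j < k -> level (n + 2 + j) = 2.
  move=> jlt; rewrite /level; do 2 (case: eqP; first by lia).
  by rewrite ltn_add2l jlt ifF //; lia.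
have lev_dead m : n + 2 + k <= m -> level m = 3.
  by move=> mge; rewrite /level; do 2 (case: eqP; first by lia); rewrite !ifF //; lia.
case: e => [i|[j d]] /=.
  rewrite /spoke; case: ifP => ev /=; rewrite lev_cell ?ltn_ord // ev //.
rewrite /slot; set q := neighbor _ _.
case: ifP => fr; last by rewrite /= lev_peg ?lev_dead //; lia.
have qE : cell_at R (index q R) = q by rewrite /cell_at nth_index //; case/andP: fr.
by case: ifP => ev; rewrite /= lev_peg // lev_cell ?free_index // qE ev.
Qed.

Lemma ends_lt e : (ends e).1 < last_vertex.+1 /\ (ends e).2 < last_vertex.+1.
Proof.
case: e => [i|[j d]] /=; rewrite /last_vertex.
  by have := ltn_ord i; rewrite /spoke; case: ifP => _ /=; lia.
have := ltn_ord j; have := direction_rank_lt d.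
rewrite /slot; set q := neighbor _ _; case: ifP => [/free_index|] fr; last by rewrite /=; lia.
by case: ifP => _ /=; lia.
Qed.

Lemma vends_val e : ((vends e).1 = (ends e).1 :> nat) * ((vends e).2 = (ends e).2 :> nat).
Proof. by have [h1 h2] := ends_lt e; rewrite /= !inordK. Qed.

(** Only spokes touch vertex 0 or 1. A slot shows its peg; its other end then fixes the direction,
    through the neighbouring cell or through the rank of the dead end. *)
Lemma ends_inj : injective ends.
Proof.
move=> [i|[j d]] [i'|[j' d']] //=.
- have := ltn_ord i; have := ltn_ord i'; rewrite /spoke.
  by case: ifP => _; case: ifP => _ _ _ [] *; congr inl; apply/val_inj => /=; lia.
- have := ltn_ord i; rewrite /spoke /slot; set q := neighbor _ _; set m := index _ _.
  by case: ifP => _; case: ifP => _; try case: ifP => _; move=> ? [] *; lia.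
- have := ltn_ord i'; rewrite /spoke /slot; set q := neighbor _ _; set m := index _ _.
  by case: ifP => _; case: ifP => _; try case: ifP => _; move=> ? [] *; lia.
have := ltn_ord j; have := ltn_ord j'.
have := direction_rank_lt d; have := direction_rank_lt d'.
rewrite /slot; set q := neighbor _ d; set q' := neighbor _ d'.
move=> dlt dlt' jlt jlt' eqs.
have fl : free_cell q -> index q R < n := @free_index q.
have fl' : free_cell q' -> index q' R < n := @free_index q'.
have jj : j = j'.
  apply/val_inj => /=; move: eqs fl fl'; set m := index q R; set m' := index q' R.
  by case: ifP => _; case: ifP => _; try case: ifP => _; try case: ifP => _; case=> *; lia.
subst j'; congr inr; congr pair.
case fq : (free_cell q) eqs fl fl' => /=; case fq' : (free_cell q') => /= eqs fl fl'.
- apply: (@neighbor_inj (cell_at P j)); rewrite -/q -/q'.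
  have iq : index q R = index q' R.
    by move: eqs (fl isT) (fl' isT); case: ifP => _; case: ifP => _ [] *; lia.
  have [qR _] := andP fq; have [qR' _] := andP fq'.
  by rewrite -(nth_index (0%R,0%R) qR) iq nth_index.
- by move: eqs (fl isT); case: ifP => _ [] *; lia.
- by move: eqs (fl' isT); case: ifP => _ [] *; lia.
- by apply: direction_rank_inj; move: eqs => [] *; lia.
Qed.

Lemma vends_inj : injective vends.
Proof.
move=> e e' eqs; apply: ends_inj; apply/eqP; rewrite -pair_eqE /pair_eq /=.
by rewrite -!vends_val eqs !eqxx.
Qed.

Lemma peg_network_is_flow_network : is_flow_network peg_network.
Proof.
have raise (u v : 'I_last_vertex.+1) : (u, v) \in edges peg_network -> level u < level v.
  by rewrite inE => /codomP[e [-> ->]]; rewrite -!/(vends e).1 !vends_val level_ends.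
have v0 : vertex 0 = 0 :> nat by rewrite inordK.
have v1 : vertex 1 = 1 :> nat by rewrite inordK // /last_vertex; lia.
have l4 m : level m <= 4 by rewrite /level; repeat case: ifP => _.
split.
- by move=> u; apply/negP => /raise; rewrite ltnn.
- by move=> u v /raise uv; apply/negP => /raise; lia.
- by move=> u; apply/negP => /raise /=; rewrite v0.
- by move=> u; apply/negP => /raise; rewrite v1 (_ : level 1 = 4) // ltnNge l4.
- by apply/eqP => /(congr1 (@nat_of_ord _)) /=; rewrite v0 v1.
Qed.

Lemma peg_network_encoding : encodes_network peg_network
  ([:: (n + 5 * k + 2)%:Z; (n + 4 * k)%:Z; 0; 1] ++
   [:: n%:Z; n%:Z] ++ nseq (n + 5 * k) 1 ++
   flatten [seq [:: e.1%:Z; e.2%:Z; 1] | e <- edge_list])%R.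
Proof.
(* [L] enumerates the edge indices in the order in which the program prints them. *)
pose L := [seq inl i | i <- enum 'I_n] ++
  [seq (inr (j, d) : edge_index) | j <- enum 'I_k, d <- directions].
have uL : uniq L.
  rewrite cat_uniq map_inj_uniq ?enum_uniq; last by move=> ? ? [].
  rewrite allpairs_uniq ?enum_uniq //; last by move=> [? ?] [? ?] _ _ [-> ->].
  rewrite andbT; apply/hasPn => e /allpairsP[[j d] [_ _ ->]].
  by apply/mapP => -[].
have inL e : e \in L.
  rewrite mem_cat; case: e => [i|[j d]].
    by rewrite map_f ?mem_enum.
  apply/orP; right; apply/allpairsP; exists (j, d); split; rewrite ?mem_enum //.
  by case: d => [[] []].
have edgeL : edge_list = [seq ends e | e <- L].
  rewrite /edge_list map_cat -map_comp; congr cat.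
    by rewrite -val_enum_ord -map_comp.
  by rewrite map_allpairs -val_enum_ord allpairs_mapl.
exists [seq vends e | e <- L].
  split; first by rewrite map_inj_uniq //; exact: vends_inj.
  move=> e; rewrite inE; apply/mapP/codomP => [[x _ ->]|[x ->]]; first by exists x.
  by exists x.
have szL : size [seq vends e | e <- L] = n + 4 * k.
  by rewrite size_map size_cat size_map size_allpairs !size_enum_ord mulnC.
rewrite szL [nvertices _]/= [src _]/= [snk _]/= !inordK //; last by rewrite /last_vertex; lia.
rewrite -addn2 /last_vertex; congr [:: _, _, _, _ & _]; first by lia.
rewrite catA edgeL; congr (_ ++ flatten _); last first.
  rewrite -!map_comp; apply: eq_map => x.
  by rewrite /= /encode_edge !vends_val.
pose cap m := Posz (if m < 2 then n else 1).
rewrite (_ : map _ _ = map cap (iota 0 last_vertex.+1)); last first.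
  by rewrite -val_enum_ord -map_comp.
rewrite (_ : last_vertex.+1 = (n + 5 * k).+2); last by rewrite /last_vertex; lia.
rewrite -[iota 0 _]/[:: 0, 1 & iota 2 (n + 5 * k)] 2!map_cons; congr [:: _, _ & _].
rewrite (@eq_in_map _ _ cap (fun=> 1%R) (iota 2 _)).1.
  by rewrite -{1}(size_iota 2 (n + 5 * k)); elim: (iota 2 _) => //= _ s ->.
by move=> m; rewrite mem_iota /cap => /andP[m2 _]; rewrite ltnNge m2.
Qed.

(** * Edges incident to each kind of vertex *)

Section CellVertex.
Variables (i : nat) (ilt : i < n).

Lemma spoke_head_cell (i' : nat) :
  ((spoke i').2 == i + 2) = (i' == i) && even_column o (cell_at R i).
Proof.
rewrite /spoke; case: (eqVneq i' i) => [->|ne]; case: ifP => _ /=; rewrite ?eqxx //; lia.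
Qed.

Lemma spoke_tail_cell (i' : nat) :
  ((spoke i').1 == i + 2) = (i' == i) && ~~ even_column o (cell_at R i).
Proof.
rewrite /spoke; case: (eqVneq i' i) => [->|ne]; case: ifP => _ /=; rewrite ?eqxx //; lia.
Qed.

Lemma slot_head_cell j d (q := neighbor (cell_at P j) d) :
  ((slot j d).2 == i + 2) = [&& free_cell q, q == cell_at R i & ~~ even_column o (cell_at R i)].
Proof.
rewrite /slot -/q; case: ifP => fr /=; last by lia.
rewrite -index_free_eq //; case: (index q R =P i) => [qi|ne].
  have -> : cell_at R i = q by rewrite -qi /cell_at nth_index //; case/andP: fr.
  by case: ifP => _ /=; rewrite ?qi ?eqxx //; lia.
by case: ifP => _ /=; lia.
Qed.

Lemma slot_tail_cell j d (q := neighbor (cell_at P j) d) :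
  ((slot j d).1 == i + 2) = [&& free_cell q, q == cell_at R i & even_column o (cell_at R i)].
Proof.
rewrite /slot -/q; case: ifP => fr /=; last by lia.
rewrite -index_free_eq //; case: (index q R =P i) => [qi|ne].
  have -> : cell_at R i = q by rewrite -qi /cell_at nth_index //; case/andP: fr.
  by case: ifP => _ /=; rewrite ?qi ?eqxx //; lia.
by case: ifP => _ /=; lia.
Qed.
End CellVertex.

Section PegVertex.
Variables (j' : nat) (jlt' : j' < k).

Lemma spoke_peg i : i < n ->
  ((spoke i).1 == n + 2 + j' = false) * ((spoke i).2 == n + 2 + j' = false).
Proof. by rewrite /spoke; case: ifP => _ ilt /=; split; lia. Qed.

Lemma slot_head_peg j d (q := neighbor (cell_at P j) d) :
  ((slot j d).2 == n + 2 + j') = (j == j') && (free_cell q && even_column o q).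
Proof.
rewrite /slot -/q; case: ifP => [/[dup] /free_index qlt fr|fr] /=; last by lia.
by case: ifP => _ /=; rewrite ?andbT ?eqn_add2l ?andbF //; lia.
Qed.

Lemma slot_tail_peg j d (q := neighbor (cell_at P j) d) :
  ((slot j d).1 == n + 2 + j') = (j == j') && ~~ (free_cell q && even_column o q).
Proof.
rewrite /slot -/q; case: ifP => [/[dup] /free_index qlt fr|fr] /=;
  last by rewrite eqn_add2l andbT.
by case: ifP => _ /=; rewrite ?andbT ?eqn_add2l ?andbF //; lia.
Qed.
End PegVertex.

Lemma ends_dead m e : n + 2 + k <= m -> (ends e).1 == m = false.
Proof.
move=> mge; case: e => [i|[j d]] /=.
  by rewrite /spoke; have := ltn_ord i; case: ifP => _ /=; lia.
have := ltn_ord j; rewrite /slot; set q := neighbor _ _.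
case: ifP => [/free_index|] fr jlt /=; last by lia.
by case: ifP => _ /=; lia.
Qed.

Lemma ends_head_dead j d e : j < k ->
  ((ends e).2 == n + 2 + k + 4 * j + direction_rank d) =
  if e is inr (j', d') then
    [&& j' == j :> nat, d' == d & ~~ free_cell (neighbor (cell_at P j') d')] else false.
Proof.
move=> jlt; case: e => [i|[j' d']] /=.
  by rewrite /spoke; have := ltn_ord i; case: ifP => _ /=; lia.
have := ltn_ord j'; rewrite /slot; set q := neighbor _ _ => jlt'.
case: ifP => [/free_index|] fr /=.
  by rewrite !andbF; case: ifP => _ /=; lia.
rewrite andbT -(inj_eq direction_rank_inj).
have := direction_rank_lt d; have := direction_rank_lt d'; lia.
Qed.

Lemma ends_source e : ((ends e).2 == 0 = false) *
  (((ends e).1 == 0) = if e is inl i then even_column o (cell_at R i) else false).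
Proof.
case: e => [i|[j d]] /=; first by rewrite /spoke; case: ifP => _ /=; split; lia.
by rewrite /slot; case: ifP => _; try case: ifP => _; split => /=; lia.
Qed.

Lemma ends_sink e : ((ends e).2 == 1) =
  if e is inl i then ~~ even_column o (cell_at R i) else false.
Proof.
case: e => [i|[j d]] /=; first by rewrite /spoke; case: ifP => _ /=; lia.
by rewrite /slot; case: ifP => _; try case: ifP => _; rewrite /=; lia.
Qed.

Lemma vends_edge e : vends e \in edges peg_network.
Proof. by rewrite inE codom_f. Qed.

(** Reindexing along this bijection turns sums over the subtype [edge] into sums over plain
    indices. *)
Definition edge_of (e : edge_index) : edge peg_network := exist _ (vends e) (vends_edge e).

Lemma edge_codom (e : edge peg_network) : val e \in codom vends.
Proof. by have := valP e; rewrite inE. Qed.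

Definition index_of (e : edge peg_network) : edge_index := iinv (edge_codom e).

Lemma edge_ofK : cancel edge_of index_of.
Proof. by move=> e; apply: vends_inj; rewrite f_iinv. Qed.

Lemma index_ofK : cancel index_of edge_of.
Proof. by move=> e; apply/val_inj; rewrite /= f_iinv. Qed.

Lemma edge_of_bij : bijective edge_of.
Proof. exact: Bijective edge_ofK index_ofK. Qed.

Let target (y : 'I_k * (bool * bool)) : cell := neighbor (cell_at P y.1) y.2.

(** * Flows as balanced edge weights *)

Section Flow.
Variable f : {ffun edge peg_network -> nat}.
Let F (e : edge_index) : nat := f (edge_of e).

Lemma inflowE v : inflow f v = \sum_(e | (ends e).2 == v) F e.
Proof.
rewrite /inflow (reindex edge_of); last exact/onW_bij/edge_of_bij.
by apply: eq_bigl => e; rewrite -val_eqE /= vends_val.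
Qed.

Lemma outflowE v : outflow f v = \sum_(e | (ends e).1 == v) F e.
Proof.
rewrite /outflow (reindex edge_of); last exact/onW_bij/edge_of_bij.
by apply: eq_bigl => e; rewrite -val_eqE /= vends_val.
Qed.
(** The flow through peg [j] along one axis, horizontal for [a = true]. Which axis carries the
    inflow depends on the column of the peg. *)
Definition load (j : 'I_k) (a : bool) : nat := F (inr (j, (a, true))) + F (inr (j, (a, false))).

(** Being a flow, stated without parity: conservation equates the two axes of a peg, and a spoke
    with the slots aimed at its cell, whatever the orientation. At a peg cell these slots are blind,
    so its spoke carries nothing. *)
Definition balanced : Prop :=
  [/\ forall i, F (inl i) <= 1,
      forall y, ~~ free_cell (target y) -> F (inr y) = 0,
      forall i : 'I_n, F (inl i) = \sum_(y | target y == cell_at R i) F (inr y)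
    & forall j, load j false = load j true /\ load j true <= 1].

Lemma sum_cell (i : 'I_n) (b : bool) :
  (forall y, ~~ free_cell (target y) -> F (inr y) = 0) ->
  \sum_(y | [&& free_cell (target y), target y == cell_at R i & b]) F (inr y) =
  if b then \sum_(y | target y == cell_at R i) F (inr y) else 0.
Proof.
move=> dead; case: b; last by rewrite big_pred0 // => y; rewrite !andbF.
rewrite [RHS](bigID (free_cell \o target)) /= [X in _ = _ + X]big1 ?addn0; last first.
  by move=> y /andP[_ /dead].
by apply: eq_bigl => y; rewrite andbT andbC.
Qed.

Lemma sum_inl_cell (i : 'I_n) (b : bool) :
  \sum_(i' : 'I_n | (i' == i :> nat) && b) F (inl i') = if b then F (inl i) else 0.
Proof.
case: b; last by rewrite big_pred0 // => i'; rewrite andbF.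
by rewrite (big_pred1 i) // => i'; rewrite andbT.
Qed.

Lemma sum_peg (j : 'I_k) (C : pred (bool * bool)) :
  \sum_(y : 'I_k * (bool * bool) | (y.1 == j :> nat) && C y.2) F (inr y) =
  \sum_(d | C d) F (inr (j, d)).
Proof.
rewrite (eq_bigr (fun y => F (inr (y.1, y.2)))) => [|[] //].
rewrite -(pair_big_dep (fun j' : 'I_k => j' == j :> nat) (fun _ => C)
  (fun j' d => F (inr (j', d)))) /=.
by rewrite (big_pred1 j).
Qed.

Lemma sum_directions (H : bool * bool -> nat) : \sum_d H d =
  H (true, true) + H (true, false) + (H (false, true) + H (false, false)).
Proof.
rewrite (eq_bigr (fun d => H (d.1, d.2))) => [|[] //].
rewrite -(pair_bigA _ (fun a b => H (a, b))) /=.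
by rewrite !big_bool.
Qed.

Lemma inflow_cell (i : 'I_n) (b := even_column o (cell_at R i)) :
  (forall y, ~~ free_cell (target y) -> F (inr y) = 0) ->
  \sum_(e | (ends e).2 == i + 2) F e =
  if b then F (inl i) else \sum_(y | target y == cell_at R i) F (inr y).
Proof.
move=> dead; rewrite big_sumType /=.
under eq_bigl do rewrite spoke_head_cell // -/b.
rewrite sum_inl_cell.
under [X in _ + X]eq_bigl do rewrite (slot_head_cell (ltn_ord i)) -/b.
by rewrite sum_cell //; case: b; rewrite ?addn0.
Qed.

Lemma outflow_cell (i : 'I_n) (b := even_column o (cell_at R i)) :
  (forall y, ~~ free_cell (target y) -> F (inr y) = 0) ->
  \sum_(e | (ends e).1 == i + 2) F e =
  if b then \sum_(y | target y == cell_at R i) F (inr y) else F (inl i).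
Proof.
move=> dead; rewrite big_sumType /=.
under eq_bigl do rewrite spoke_tail_cell // -/b.
rewrite sum_inl_cell.
under [X in _ + X]eq_bigl do rewrite (slot_tail_cell (ltn_ord i)) -/b.
by rewrite sum_cell //; case: b; rewrite ?addn0.
Qed.

(** Around a peg in an even column the even neighbours are the vertical ones; in an odd column they
    are the horizontal ones. *)
Lemma inflow_peg (j : 'I_k) :
  (forall y, ~~ free_cell (target y) -> F (inr y) = 0) ->
  \sum_(e | (ends e).2 == n + 2 + j) F e = load j (~~ even_column o (cell_at P j)).
Proof.
move=> dead; rewrite big_sumType /= big_pred0 ?add0n; last first.
  by move=> i; rewrite spoke_peg.
under eq_bigl => y.
  have -> : ((slot y.1 y.2).2 == n + 2 + j) = (y.1 == j :> nat) &&
     (let q := neighbor (cell_at P j) y.2 in free_cell q && even_column o q).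
    by rewrite slot_head_peg //; case: eqP => // ->.
  over.
rewrite (sum_peg j (fun d => let q := neighbor (cell_at P j) d in free_cell q && even_column
  o q)).
rewrite big_mkcond sum_directions /= !even_column_neighbor /=.
have dF d : (if free_cell (neighbor (cell_at P j) d) then F (inr (j, d)) else 0) = F (inr (j,
  d)).
  by case: ifPn => // /(dead (j, d)) ->.
by rewrite /load; case: even_column; rewrite /= ?andbF ?andbT !dF ?addn0.
Qed.

Lemma outflow_peg (j : 'I_k) :
  (forall y, ~~ free_cell (target y) -> F (inr y) = 0) ->
  \sum_(e | (ends e).1 == n + 2 + j) F e = load j (even_column o (cell_at P j)).
Proof.
move=> dead; rewrite big_sumType /= big_pred0 ?add0n; last first.
  by move=> i; rewrite spoke_peg.
under eq_bigl => y.
  have -> : ((slot y.1 y.2).1 == n + 2 + j) = (y.1 == j :> nat) &&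
     ~~ (let q := neighbor (cell_at P j) y.2 in free_cell q && even_column o q).
    by rewrite slot_tail_peg //; case: eqP => // ->.
  over.
rewrite (sum_peg j (fun d => ~~ let q := neighbor (cell_at P j) d in free_cell q &&
  even_column o q)).
rewrite big_mkcond sum_directions /= !even_column_neighbor /=.
have dF d : (if ~~ free_cell (neighbor (cell_at P j) d) then F (inr (j, d)) else 0) = 0.
  by case: ifPn => // /(dead (j, d)) ->.
by rewrite /load; case: even_column; rewrite /= ?andbF ?andbT /= ?dF ?addn0.
Qed.

Lemma vertex_cases m (lt : m < last_vertex.+1) :
  [\/ m = 0 \/ m = 1, exists i : 'I_n, m = i + 2, exists j : 'I_k, m = n + 2 + j
   | exists (j : 'I_k) d, m = n + 2 + k + 4 * j + direction_rank d].
Proof.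
have [->|m0] := eqVneq m 0; first by constructor 1; left.
have [->|m1] := eqVneq m 1; first by constructor 1; right.
have [mn|mn] := ltnP m (n + 2).
  have ilt : m - 2 < n by lia.
  by constructor 2; exists (Ordinal ilt) => /=; lia.
have [mk|mk] := ltnP m (n + 2 + k).
  have jlt : m - (n + 2) < k by lia.
  by constructor 3; exists (Ordinal jlt) => /=; lia.
constructor 4; rewrite /last_vertex in lt.
have jlt : (m - (n + 2 + k)) %/ 4 < k by rewrite ltn_divLR //; lia.
have : (m - (n + 2 + k)) %% 4 < 4 by rewrite ltn_mod.
have mE := divn_eq (m - (n + 2 + k)) 4.
case rE: (_ %% _) mE => [|[|[|[|//]]]] mE _; exists (Ordinal jlt).
- by exists (true, true); rewrite /direction_rank /=; lia.
- by exists (true, false); rewrite /direction_rank /=; lia.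
- by exists (false, true); rewrite /direction_rank /=; lia.
- by exists (false, false); rewrite /direction_rank /=; lia.
Qed.

Lemma sum_inl_le (C : pred 'I_n) : (forall i, F (inl i) <= 1) ->
  \sum_(i | C i) F (inl i) <= n.
Proof.
move=> cap; apply: (@leq_trans (\sum_(i | C i) 1)); first by apply: leq_sum => i _; exact: cap.
by rewrite sum1_card -[X in _ <= X]card_ord max_card.
Qed.

(** Nothing leaves a dead end, so conservation there kills the blind slots; the other clauses of
    [balanced] come from conservation at cells and pegs and from the unit capacities of spokes and
    pegs. *)
Lemma flowP : is_flow f <-> balanced.
Proof.
have vert m : m < last_vertex.+1 -> exists v : 'I_last_vertex.+1, v = m :> nat.
  by move=> mlt; exists (Ordinal mlt).
split=> [[cap vcap conserve]|[cap dead cells pegs]].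
  have cons m : m < last_vertex.+1 -> 1 < m ->
      \sum_(e | (ends e).2 == m) F e = \sum_(e | (ends e).1 == m) F e.
    move=> /vert[v <-] m1; rewrite -inflowE -outflowE; apply: conserve.
      by apply: contraTneq m1 => -> /=; rewrite inordK.
    by apply: contraTneq m1 => -> /=; rewrite inordK // /last_vertex; lia.
  have dead y : ~~ free_cell (target y) -> F (inr y) = 0.
    case: y => j d nfr; have := cons (n + 2 + k + 4 * j + direction_rank d) _ _.
    rewrite [X in _ = X]big_pred0; last by move=> e; rewrite ends_dead //; lia.
    have := direction_rank_lt d; have := ltn_ord j; rewrite /last_vertex => jlt dlt.
    move=> /(_ ltac:(lia) ltac:(lia)) /eqP; rewrite sum_nat_eq0 => /forallP/(_ (inr (j, d))).
    by rewrite ends_head_dead // !eqxx nfr => /eqP.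
  split=> //.
  - by move=> i; exact: cap.
  - move=> i; have := cons (i + 2) _ _; rewrite inflow_cell // outflow_cell //.
    have := ltn_ord i; rewrite /last_vertex => ilt.
    by move=> /(_ ltac:(lia) ltac:(lia)); case: ifP.
  move=> j; have jlt := ltn_ord j.
  have plt : n + 2 + j < last_vertex.+1 by rewrite /last_vertex; lia.
  have := cons _ plt ltac:(lia); have [v vE] := vert _ plt.
  have := vcap v; rewrite inflowE vE inflow_peg // outflow_peg // /peg_network /= vE.
  rewrite ifF; last by lia.
  by case: even_column => /=; lia.
(* The capacity of a slot follows from that of its peg, as the slot is one term of a load. *)
have cap1 e : F e <= 1.
  case: e => [i|[j [a b]]]; first exact: cap.
  by have := pegs j; rewrite /load; case: a; case: b; lia.
split.
- by move=> e; have [g _ gK] := edge_of_bij; rewrite -(gK e); exact: cap1.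
- move=> v; rewrite inflowE /=; have [[-> //|->]|[i ->]|[j ->]|[j [d ->]]] := vertex_cases
    (ltn_ord v).
  + by rewrite big_pred0 // => e; rewrite ends_source.
  + under eq_bigl do rewrite ends_sink.
    by rewrite big_sumType /= big_pred0_eq addn0 sum_inl_le.
  + rewrite (_ : (i + 2 < 2) = false) ?inflow_cell -?cells //; last by lia.
    by rewrite if_same.
  + rewrite (_ : (n + 2 + j < 2) = false) ?inflow_peg //; last by lia.
    by have := pegs j; case: even_column => /=; lia.
  + rewrite big1 // => -[i|y]; rewrite ends_head_dead //.
    by case: y => j' d' /and3P[_ _ /(dead (j', d'))].
- move=> v v0 v1; rewrite inflowE outflowE.
  have [[vE|vE]|[i ->]|[j ->]|[j [d ->]]] := vertex_cases (ltn_ord v).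
  + by case/eqP: v0; apply/val_inj; rewrite /= vE inordK.
  + by case/eqP: v1; apply/val_inj; rewrite /= vE inordK // /last_vertex; lia.
  + by rewrite inflow_cell // outflow_cell // -cells !if_same.
  + by rewrite inflow_peg // outflow_peg //; have [e _] := pegs j; case: even_column.
  + rewrite [RHS]big_pred0; last by move=> e; rewrite ends_dead //; lia.
    rewrite big1 // => -[i|y]; rewrite ends_head_dead //.
    by case: y => j' d' /and3P[_ _ /(dead (j', d'))].
Qed.

(** The source feeds only even cells, which pass the flow to the slots with an even target. At each
    peg these slots form one axis, and both axes carry the same load. *)
Lemma flow_valueE : is_flow f -> flow_value f = \sum_j load j true.
Proof.
case/flowP=> cap dead cells pegs; rewrite /flow_value outflowE /= inordK //.
under eq_bigl do rewrite ends_source.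
rewrite big_sumType /= big_pred0_eq addn0.
under eq_bigr do rewrite cells.
rewrite (exchange_big_dep predT) //=.
have -> : \sum_j load j true = \sum_y if even_column o (target y) then F (inr y) else 0.
  rewrite [RHS](eq_bigr (fun y => if even_column o (target (y.1, y.2)) then F (inr (y.1,
    y.2)) else 0)) => [|[] //].
  rewrite -(pair_bigA _ (fun j d => if even_column o (target (j, d)) then F (inr (j, d)) else
    0)).
  apply: eq_bigr => j _ /=; rewrite sum_directions /target /= !even_column_neighbor /=.
  by have [e _] := pegs j; rewrite -/(load j false) /load in e *; case: even_column => /=; lia.
(* After the exchange, the slot [y] is counted once for each even cell equal to its target: once if
   that target is free and even. *)
apply: eq_bigr => y _; rewrite sum_nat_cond_const.
case fr: (free_cell (target y)); last by rewrite dead ?fr // muln0 if_same.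
have ilt := free_index fr; pose i := Ordinal ilt.
have qE : cell_at R i = target y by rewrite /cell_at nth_index //; case/andP: fr.
have -> : [set i' : 'I_n | even_column o (cell_at R i') & target y == cell_at R i']%SET =
    if even_column o (target y) then [set i]%SET else finset.set0.
  apply/finset.setP => i'; rewrite inE -index_free_eq //.
  have -> : (index (target y) R == i') = (i' == i) by rewrite eq_sym.
  by case: eqVneq => [->|ne]; rewrite ?qE ?andbF ?andbT; case: ifP;
    rewrite !inE ?eqxx ?(negbTE ne).
by case: ifP; rewrite ?cards1 ?cards0 ?mul1n.
Qed.

Lemma flow_value_le : is_flow f -> flow_value f <= k.
Proof.
move=> fl; rewrite flow_valueE //; case/flowP: fl => _ _ _ pegs.
apply: (@leq_trans (\sum_(j < k) 1)); first by apply: leq_sum => j _; case: (pegs j).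
by rewrite sum1_card card_ord.
Qed.

(** The value is a sum of k loads, each at most 1, so the value k leaves no slack. *)
Lemma full_load : is_flow f -> flow_value f = k -> forall j a, load j a = 1.
Proof.
move=> fl; rewrite flow_valueE // => valE; case/flowP: fl => _ _ _ pegs.
suff full j : load j true = 1 by move=> j []; rewrite ?(pegs j).1.
have : \sum_(j < k) (1 - load j true) = 0.
  by rewrite sumnB ?valE ?sum1_card ?card_ord ?subnn // => i _; case: (pegs i).
move/eqP; rewrite sum_nat_eq0 => /forallP/(_ j) /= /eqP; have := (pegs j).2; lia.
Qed.

End Flow.

(** * Sign assignments, the common source of flows and covers *)

Section Assignments.
Implicit Type g : {ffun 'I_k * bool -> bool}.

Definition tip g (x : 'I_k * bool) : cell := neighbor (cell_at P x.1) (x.2, g x).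

(** Coverage of the free cells is then a matter of counting, done in [tip_surj]. *)
Definition valid g : Prop := (forall x, free_cell (tip g x)) /\ injective (tip g).

(** A spoke counts the tips on its cell. Taking the sum, which may exceed 1 when [g] is not valid,
    defines [flow_of] on all assignments. *)
Definition weight g (e : edge_index) : nat :=
  match e with
  | inl i => \sum_x (tip g x == cell_at R i)
  | inr y => g (y.1, y.2.1) == y.2.2
  end.

Definition flow_of g : {ffun edge peg_network -> nat} :=
  [ffun e => weight g (index_of e)].

Lemma flow_of_edge g e : flow_of g (edge_of e) = weight g e.
Proof. by rewrite ffunE edge_ofK. Qed.

(** On each axis of a peg exactly one of the two slots has weight 1, the one aimed at the tip. *)
Lemma weight_cell g (i : 'I_n) :
  weight g (inl i) = \sum_(y | target y == cell_at R i) weight g (inr y).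
Proof.
rewrite big_mkcond /= (eq_bigr (fun y : 'I_k * (bool * bool) =>
  if target (y.1, (y.2.1, y.2.2)) == cell_at R i then (g (y.1, y.2.1) == y.2.2) : nat else 0));
  last by move=> [? [? ?]].
rewrite -(pair_bigA _ (fun j (d : bool * bool) =>
  if target (j, (d.1, d.2)) == cell_at R i then (g (j, d.1) == d.2) : nat else 0)) /=.
rewrite (eq_bigr (fun x => (tip g (x.1, x.2) == cell_at R i) : nat)); last by move=> [].
rewrite -(pair_bigA _ (fun j a => (tip g (j, a) == cell_at R i) : nat)) /=.
apply: eq_bigr => j _; rewrite sum_directions big_bool /tip /target /=.
by case: (g _); case: (g _); do ?case: ifP.
Qed.

Lemma sum_tip_le1 g c : injective (tip g) -> \sum_x (tip g x == c) <= 1.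
Proof.
move=> inj; have [/existsP[x /eqP xc]|/existsPn none] := boolP [exists x, tip g x == c].
  rewrite (bigD1 x) //= xc eqxx big1 // => y yx.
  by apply/eqP; rewrite eqb0 -xc (inj_eq inj).
by rewrite big1 // => x _; rewrite (negbTE (none x)).
Qed.

Lemma flow_of_balanced g : valid g -> balanced (flow_of g).
Proof.
move=> [fr inj]; split.
- by move=> i; rewrite flow_of_edge sum_tip_le1.
- move=> [j [a b]] nfr; rewrite flow_of_edge /=; apply/eqP; rewrite eqb0.
  by apply: contraNneq nfr => <-; exact: (fr (j, a)).
- by move=> i; rewrite flow_of_edge weight_cell; apply: eq_bigr => y _; rewrite flow_of_edge.
- by move=> j; rewrite /load !flow_of_edge /=; case: (g _); case: (g _).
Qed.

Lemma flow_of_flow g : valid g -> is_flow (flow_of g) /\ flow_value (flow_of g) = k.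
Proof.
move=> vg; have fl : is_flow (flow_of g) by apply/flowP/flow_of_balanced.
split=> //; rewrite flow_valueE // (eq_bigr (fun=> 1)) ?sum1_card ?card_ord // => j _.
by rewrite /load !flow_of_edge /=; case: (g _).
Qed.

Lemma flow_of_inj : injective flow_of.
Proof.
move=> g g' eqs; apply/ffunP => -[j a].
have := congr1 (fun f : {ffun edge peg_network -> nat} => f (edge_of (inr (j, (a, true))))) eqs.
by rewrite !flow_of_edge /=; case: (g _); case: (g' _).
Qed.

(** A load of 1 sits on exactly one of the two slots of an axis; [g] records whether it is the
    positive one. *)
Lemma flow_of_surj f : is_flow f -> flow_value f = k -> exists2 g, valid g & f = flow_of g.
Proof.
move=> fl val; have full := full_load fl val.
case/flowP: fl => cap dead cells _.
pose g := [ffun x : 'I_k * bool => f (edge_of (inr (x.1, (x.2, true)))) == 1].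
have slotE y : f (edge_of (inr y)) = weight g (inr y).
  case: y => j [a b]; rewrite /= ffunE /=; have := full j a; rewrite /load.
  by case: b; case: eqP => //=; lia.
have spokeE i : f (edge_of (inl i)) = weight g (inl i).
  by rewrite cells weight_cell; apply: eq_bigr => y _; rewrite slotE.
have fr x : free_cell (tip g x).
  apply/negPn/negP => /(dead (x.1, (x.2, g x))); rewrite slotE /=.
  by case: x => j a /=; rewrite eqxx.
exists g; last first.
  apply/ffunP => e; rewrite -(index_ofK e) flow_of_edge.
  by case: (index_of e) => [i|y].
split=> // x y xy; apply/eqP/negPn/negP => ne.
(* Two tips on one cell would put at least 2 on its spoke, against capacity 1. *)
have ilt := free_index (fr x); have := cap (Ordinal ilt).
have tE : cell_at R (Ordinal ilt) = tip g x.
  by rewrite /cell_at nth_index //; case/andP: (fr x).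
rewrite spokeE /= tE (bigD1 x) //= (bigD1 y) /=; last by rewrite eq_sym.
by rewrite -xy !eqxx.
Qed.

Definition cover_of g : set tromino :=
  [set t | exists j : 'I_k, t = tromino_at (cell_at P j) (g (j, true)) (g (j, false))]%classic.

(** There are 2k distinct tips, and [n = 3 * k] leaves exactly 2k free cells. *)
Lemma tip_surj g q : n = 3 * k -> valid g -> free_cell q -> exists x, q = tip g x.
Proof.
move=> nk [fr inj] qfr.
pose tips := [seq tip g x | x <- enum {: 'I_k * bool}].
have utips : uniq tips by rewrite map_inj_uniq ?enum_uniq.
have sub : {subset tips <= [seq c <- R | c \notin P]}.
  by move=> _ /mapP[x _ ->]; rewrite mem_filter andbC; exact: fr.
have szP : size [seq c <- R | c \in P] = k.
  apply: perm_size; apply: uniq_perm => // [|c]; first exact: filter_uniq.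
  by rewrite mem_filter; case cP: (c \in P) => //=; exact: PR.
have sz : size [seq c <- R | c \notin P] <= size tips.
  rewrite size_map -cardE card_prod card_ord card_bool.
  have : size [seq c <- R | c \in P] + size [seq c <- R | c \notin P] = n.
    by rewrite !size_filter; exact: count_predC.
  by rewrite szP nk mulSn => /addnI ->; rewrite mulnC.
have [_ eqi] := uniq_min_size utips sub sz.
have : q \in tips by rewrite eqi mem_filter andbC.
by case/mapP=> x _ ->; exists x.
Qed.

Lemma cover_of_pcover g : n = 3 * k -> valid g -> is_pcover R P (cover_of g).
Proof.
move=> nk vg; have [fr inj] := vg.
have pegP (j : 'I_k) : cell_at P j \in P by apply: cell_at_mem.
have memP q : reflect (exists j : 'I_k, q = cell_at P j) (q \in P).
  apply: (iffP idP) => [qP|[j ->] //].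
  have jlt : index q P < k by rewrite index_mem.
  by exists (Ordinal jlt); rewrite /cell_at /= nth_index.
have hE (j : 'I_k) : neighbor (cell_at P j) (true, g (j, true)) = tip g (j, true) by [].
have vE (j : 'I_k) : neighbor (cell_at P j) (false, g (j, false)) = tip g (j, false) by [].
split.
- move=> _ [j ->]; split; rewrite /= ?hE ?vE //.
  + exact: is_tromino_at.
  + move=> c; rewrite !inE /= => /or3P[] /eqP ->; rewrite ?hE ?vE.
    * exact: PR.
    * by case/andP: (fr (j, true)).
    * by case/andP: (fr (j, false)).
  + by case/andP: (fr (j, true)).
  + by case/andP: (fr (j, false)).
- move=> _ _ c [j ->] [j' ->]; rewrite !inE /= !hE !vE => cj cj'.
  suff -> : j = j' by [].
  have tipP x : tip g x \notin P by case/andP: (fr x).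
  (* A shared cell is the corner of both trominoes if it carries a peg, and a tip of both
     otherwise. *)
  case cP : (c \in P).
    have corner x : c == tip g x = false.
      by apply/eqP => cx; move: (tipP x); rewrite -cx cP.
    move: cj cj'; rewrite !corner !orbF => /eqP -> /eqP /eqP.
    by rewrite nth_uniq // => /eqP /val_inj.
  have ncorner (i : 'I_k) : c == cell_at P i = false.
    by apply/eqP => ci; rewrite ci pegP in cP.
  move: cj cj'; rewrite !ncorner /=.
  by case/orP=> /eqP -> /orP[] /eqP /inj [].
- move=> c cR; case: (boolP (c \in P)) => [/memP[j ->]|cP].
    exists (tromino_at (cell_at P j) (g (j, true)) (g (j, false))); first by exists j.
    by rewrite inE eqxx.
  have [|[j a] cE] := @tip_surj g c nk vg; first by apply/andP.
  exists (tromino_at (cell_at P j) (g (j, true)) (g (j, false))); first by exists j.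
  by rewrite !inE /= hE vE cE; case: a {cE}; rewrite eqxx ?orbT.
Qed.

Lemma cover_of_inj : injective cover_of.
Proof.
move=> g g' eqs; apply/ffunP => -[j a].
have : cover_of g' (tromino_at (cell_at P j) (g (j, true)) (g (j, false))).
  by rewrite -eqs; exists j.
case=> j' tE; have /= cE := congr1 corner tE.
have hE : neighbor _ _ = neighbor _ _ := congr1 htip tE.
have vE : neighbor _ _ = neighbor _ _ := congr1 vtip tE.
have jj : j = j' by apply/val_inj/eqP; rewrite /= -(nth_uniq (0%R, 0%R) (ltn_ord j) (ltn_ord
  j') uP); exact/eqP.
subst j'; move/neighbor_inj: hE => -[hE]; move/neighbor_inj: vE => -[vE].
by case: a.
Qed.

(** Every peg cell is covered, and only by a corner because tips avoid pegs; so a cover holds one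
    tromino per peg, and [g] reads off its signs. *)
Lemma cover_of_surj T : is_pcover R P T -> exists2 g, valid g & T = cover_of g.
Proof.
move=> [Tp Tdisj Tcov].
have memP (q : cell) : q \in P -> exists j : 'I_k, q = cell_at P j.
  move=> qP; have jlt : index q P < k by rewrite index_mem.
  by exists (Ordinal jlt); rewrite /cell_at /= nth_index.
have /fin_all_exists[g gP] (x : 'I_k * bool) : exists b, exists t, exists h v,
    [/\ T t, t = tromino_at (cell_at P x.1) h v & b = if x.2 then h else v].
  have cP : cell_at P x.1 \in P by apply: cell_at_mem.
  have [t Tt ct] := Tcov _ (PR cP); have [tt _ tc th tv] := Tp _ Tt.
  have cE : corner t = cell_at P x.1.
    move: ct; rewrite !inE => /or3P[] /eqP ct //.
      by rewrite -ct cP in th.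
    by rewrite -ct cP in tv.
  have [h [v tE]] := is_trominoP tt; rewrite cE in tE.
  by exists (if x.2 then h else v), t, h, v.
(* The choice was made separately for each axis; the two chosen trominoes share their corner, hence
   coincide. *)
have Tg (j : 'I_k) : T (tromino_at (cell_at P j) (g (j, true)) (g (j, false))).
  have [t [h [v [Tt tE /= ->]]]] := gP (j, true).
  have [t' [h' [v' [Tt' tE' /= ->]]]] := gP (j, false).
  have tt' : t = t'.
    apply: (Tdisj _ _ (cell_at P j) Tt Tt'); first by rewrite tE inE eqxx.
    by rewrite tE' inE eqxx.
  have vE : neighbor _ _ = neighbor _ _ := congr1 vtip (etrans (esym tE) (etrans tt' tE')).
  by move/neighbor_inj: vE => -[<-]; rewrite -tE.
pose f := [ffun x => g x].
exists f.
  split=> [[j a]|[j a] [j' a'] tE].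
    have [_ sub _ hP vP] := Tp _ (Tg j); rewrite /tip ffunE /free_cell.
    by case: a; rewrite ?hP ?vP ?sub //= !inE eqxx ?orbT.
  move: tE; rewrite /tip !ffunE /= => tE.
  have intip (i : 'I_k) b : neighbor (cell_at P i) (b, g (i, b)) \in
      tromino_cells (tromino_at (cell_at P i) (g (i, true)) (g (i, false))).
    by case: b; rewrite !inE eqxx ?orbT.
  have := Tdisj _ _ _ (Tg j) (Tg j') (intip j a); rewrite tE => /(_ (intip j' a')) /(congr1
    corner) /= cE.
  have jj : j = j' by apply/val_inj/eqP; rewrite /= -(nth_uniq (0%R, 0%R) (ltn_ord j)
    (ltn_ord j') uP); exact/eqP.
  by move: tE; rewrite jj => /neighbor_inj [->].
rewrite eqEsubset; split=> [t Tt|_ [j ->]]; last by rewrite !ffunE.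
have [_ _ cP _ _] := Tp _ Tt; have [j jE] := memP _ cP.
exists j; rewrite !ffunE; apply: (Tdisj _ _ (corner t) Tt (Tg j)); first by rewrite inE eqxx.
by rewrite jE inE eqxx.
Qed.

Lemma parsimonious : n = 3 * k ->
  (max_flow_value peg_network k <-> exists T, is_pcover R P T) /\
  exists N,
    ([set T | is_pcover R P T]%classic #= `I_N)%card /\
    ([set f : {ffun edge peg_network -> nat} | is_flow f /\ flow_value f = k]%classic #=
      `I_N)%card.
Proof.
move=> nk; split.
  split=> [[[f fl val] _]|[T /cover_of_surj[g vg _]]].
    have [g vg _] := flow_of_surj fl val.
    by exists (cover_of g); exact: cover_of_pcover.
  have [fl val] := flow_of_flow vg.
  by split; [exists (flow_of g)|exact: flow_value_le].
have [N gN] : finite_set [set g | valid g]%classic by exact: finite_finset.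
have image_card (U : Type) (A : set U) (h : {ffun 'I_k * bool -> bool} -> U) :
    injective h -> A = (h @` [set g | valid g])%classic -> (A #= `I_N)%card.
  by move=> hinj ->; apply: card_eq_trans gN; apply: inj_card_eq => g g' _ _ /hinj.
exists N; split.
  apply: (image_card _ _ _ cover_of_inj); rewrite eqEsubset; split=> [T|_ [g vg <-]] /=.
    by case/cover_of_surj=> g vg ->; exists g.
  exact: cover_of_pcover.
apply: (image_card _ _ _ flow_of_inj); rewrite eqEsubset; split=> [f [fl val]|_ [g vg <-]] /=.
  by have [g vg ->] := flow_of_surj fl val; exists g.
exact: flow_of_flow.
Qed.
End Assignments.
End FlowNetwork.

(** * The program *)

Section Program.
Local Open Scope nat_scope.
Local Notation "c1 ;; c2" := (Seq c1 c2) (at level 61, right associativity).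
Local Coercion Do : instr >-> cmd.

(* Registers: 0 and 1 hold the constants 0 and 1; 2 = n, 3 = k, 4 = the row width
   2n+1, 5 = loop counter, 10 and 11 = offsets making coordinates nonnegative,
   20 = whether the offsets are known, 22 = current peg vertex, 23 = next dead end,
   24 = start of the list of peg addresses, 26 = start of the table of rows. *)
Definition print_header : cmd :=
  Read 2;; Read 3;; Const 1 1%R;;
  Plus 4 2 2;; Plus 4 4 1;;
  Plus 22 2 1;; Plus 22 22 1;; Plus 23 22 3;;
  Plus 9 3 3;; Plus 9 9 9;; Plus 5 9 23;; Print 5;;
  Plus 9 9 2;; Print 9;; Print 0;; Print 1;; Print 2;; Print 2;;
  Minus 5 5 1;; Minus 5 5 1.

Definition print_capacity : cmd := Print 1;; Minus 5 5 1.

Definition start_rows : cmd :=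
  Const 26 32%R;; Plus 6 26 0;; Plus 24 26 4;; Plus 24 24 4;; Plus 7 24 4;;
  Plus 8 1 0;; Plus 5 4 0.

(** Subtracting register 8 from 1 swaps 0 and 1, which yields the parity of successive row
    numbers. *)
Definition make_row : cmd :=
  Store 6 7;; Plus 9 6 4;; Store 9 8;; Plus 6 6 1;; Plus 7 7 4;; Minus 8 1 8;;
  Minus 5 5 1.

Definition start_cells : cmd := Plus 5 2 0;; Const 16 2%R.

(** Register 10 includes the start of the row table, so one addition gives the entry of a column;
    its parity bit lies one width further. The address ends up in 14 and the parity in 25. *)
Definition locate : cmd :=
  Plus 9 12 10;; Plus 15 9 4;; Fetch 14 9;; Fetch 25 15;; Plus 14 14 13;;
  Plus 14 14 11.

(** The first cell fixes the offsets, which place it at the centre (n, n) of the table. *)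
Definition read_cell : cmd :=
  Read 12;; Read 13;;
  Unless 20 (Minus 10 26 12;; Plus 10 10 2;; Minus 11 2 13;; Plus 20 1 0).

Definition print_spoke : cmd :=
  locate;; Plus 17 0 0;; Plus 18 16 0;; Plus 19 16 0;;
  Unless 25 (Plus 17 16 0;; Plus 18 1 0;; Minus 19 0 16);;
  Print 17;; Print 18;; Print 1;; Store 14 19;; Plus 16 16 1;; Minus 5 5 1.

Definition start_pegs : cmd := Plus 5 3 0;; Plus 21 24 0.

(** Writing 0 makes a peg look like a cell outside the region. All pegs must be erased before any
    slot is printed, and the input is read once, so the addresses are saved for a second pass. *)
Definition read_peg : cmd :=
  Read 12;; Read 13;; locate;; Store 14 0;; Store 21 14;; Plus 21 21 1;; Minus 5 5 1.

(** A positive entry is an even free cell, a negative one an odd free cell, 0 selects the dead end.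
    Register 23 advances in all cases, so dead ends are numbered by slot. *)
Definition print_slot : cmd :=
  Fetch 19 14;; Plus 17 19 0;; Plus 18 22 0;;
  Unless 19 (Minus 18 0 19;; Unless 18 (Plus 18 23 0);; Plus 17 22 0);;
  Print 17;; Print 18;; Print 1;; Plus 23 23 1.

(** Neighbours are reached from the address alone: one width away for columns, 1 away within a
    column. *)
Definition print_slots : cmd :=
  Fetch 15 21;;
  (Plus 14 15 4;; print_slot);; (Minus 14 15 4;; print_slot);;
  (Plus 14 15 1;; print_slot);; (Minus 14 15 1;; print_slot);;
  Plus 21 21 1;; Plus 22 22 1;; Minus 5 5 1.

Definition reduction : cmd :=
  print_header;; Repeat print_capacity 5;;
  start_rows;; Repeat make_row 5;;
  start_cells;; Repeat (read_cell;; print_spoke) 5;;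
  start_pegs;; Repeat read_peg 5;;
  start_pegs;; Repeat print_slots 5.

Local Open Scope ring_scope.

(** * Loop invariants and correctness of the program *)

Section Correctness.
Variables (R P : seq cell).
Let n := size R.
Let k := size P.
Let origin : cell := cell_at R 0.
Let o : int := n%:Z - origin.1.
Let o' : int := n%:Z - origin.2.
Let width : int := n%:Z + n%:Z + 1.
Let rows : int := 32.
Let parities : int := rows + width.
Let pegs : int := parities + width.
Let table : int := pegs + width.

Let in_range (q : cell) : Prop := 0 <= q.1 + o < width /\ 0 <= q.2 + o' < width.
Let address (q : cell) : int := table + (q.1 + o) * width + (q.2 + o').

Hypotheses (uR : uniq R) (uP : uniq P) (PR : {subset P <= R}).
Hypotheses (n_gt0 : (0 < n)%N) (k_gt0 : (0 < k)%N) (k_le_n : (k <= n)%N).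
Hypothesis extent : forall q : cell, q \in R ->
  `|q.1 - origin.1| < n%:Z /\ `|q.2 - origin.2| < n%:Z.

Lemma in_range_cell (q : cell) : q \in R -> in_range q.
Proof. by move=> /extent; rewrite /in_range /o /o' /width => -[h1 h2]; split; lia. Qed.

(** With the first cell at n and a strict extent, shifted coordinates of cells run from 1 to 2n-1.
    The margin leaves the neighbours between 0 and 2n, whence the width 2n+1. *)
Lemma in_range_neighbor (q : cell) d : q \in R -> in_range (neighbor q d).
Proof.
move=> /extent; rewrite /in_range /o /o' /width /neighbor => -[h1 h2].
by case: d => [[] []] /=; split; lia.
Qed.

(** Up to the base of the table, an address is a two-digit number in base [width]. *)
Lemma address_inj (q r : cell) : in_range q -> in_range r -> address q = address r -> q = r.
Proof.
case: q r => x y [x' y'] [/= qx qy] [/= rx ry]; rewrite /address /= => eqs.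
have xx : x + o = x' + o by nia.
have yy : y + o' = y' + o' by move: eqs; rewrite xx; lia.
by congr pair; lia.
Qed.

Lemma address_ge (q : cell) : in_range q -> table <= address q.
Proof. by move=> [h1 h2]; rewrite /address; nia. Qed.

Lemma address_neighbor (q : cell) d : address (neighbor q d) =
  address q + (if d.2 then 1 else -1) * (if d.1 then width else 1).
Proof. by rewrite /address /neighbor; case: d => [[] []] /=; lia. Qed.

(* The table holds [signed q] at a free cell q and 0 elsewhere, so that the sign of
   an entry tells whether the edge of a slot leaves the cell, enters it, or goes to a
   dead end. *)
Definition signed (q : cell) : int :=
  if even_column o q then (index q R + 2)%N%:Z else - (index q R + 2)%N%:Z.

Definition triples (s : seq (nat * nat)) : seq int :=
  flatten [seq [:: e.1%:Z; e.2%:Z; 1] | e <- s].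

Lemma triples_rcons s e : triples (rcons s e) = triples s ++ [:: e.1%:Z; e.2%:Z; 1].
Proof. by rewrite /triples -cats1 map_cat flatten_cat. Qed.

Definition header : seq int :=
  [:: (n + 5 * k + 2)%N%:Z; (n + 4 * k)%N%:Z; 0; 1; n%:Z; n%:Z].

Record constants (s : conf) : Prop := Constants {
  reg_zero : scal s 0 = 0; reg_one : scal s 1 = 1; reg_n : scal s 2 = n%:Z;
  reg_k : scal s 3 = k%:Z; reg_width : scal s 4 = width }.

Record capacities (i : nat) (s : conf) : Prop := Capacities {
  cap_const : constants s;
  cap_peg : scal s 22 = (n + 2)%N%:Z;
  cap_dead : scal s 23 = (n + 2 + k)%N%:Z;
  cap_known : scal s 20 = 0;
  cap_count : scal s 5 = (n + 5 * k)%N%:Z - i%:Z;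
  cap_heap : forall a, heap s a = 0;
  cap_in : tin s = encode_cells R ++ encode_cells P;
  cap_out : tout s = header ++ nseq i 1 }.

Definition row_tables (c : nat) (h : int -> int) : Prop :=
  forall c', (c' < c)%N -> h (rows + c'%:Z) = table + c'%:Z * width /\
    h (parities + c'%:Z) = (~~ odd c')%:Z.

Record layout (s : conf) : Prop := Layout {
  lay_const : constants s;
  lay_peg : scal s 22 = (n + 2)%N%:Z;
  lay_dead : scal s 23 = (n + 2 + k)%N%:Z;
  lay_rows : scal s 26 = rows;
  lay_pegs : scal s 24 = pegs }.

Record rows_made (c : nat) (s : conf) : Prop := RowsMade {
  row_layout : layout s;
  row_known : scal s 20 = 0;
  row_count : scal s 5 = width - c%:Z;
  row_pointer : scal s 6 = rows + c%:Z;
  row_base : scal s 7 = table + c%:Z * width;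
  row_parity : scal s 8 = (~~ odd c)%:Z;
  row_heap : row_tables c (heap s);
  row_blank : forall a, table <= a -> heap s a = 0;
  row_in : tin s = encode_cells R ++ encode_cells P;
  row_out : tout s = header ++ nseq (n + 5 * k) 1 }.

Definition all_rows := row_tables (n + n + 1).

(** The offsets are known only once a cell has been read, hence the case on [i]. The table clause
    ranges over all addresses in range, since the slots will also probe cells outside the region. *)
Record cells_read (i : nat) (s : conf) : Prop := CellsRead {
  cell_layout : layout s;
  cell_known : if i is 0 then scal s 20 = 0
    else [/\ scal s 20 = 1, scal s 10 = rows + o & scal s 11 = o'];
  cell_count : scal s 5 = n%:Z - i%:Z;
  cell_vertex : scal s 16 = (i + 2)%N%:Z;
  cell_rows : all_rows (heap s);
  cell_table : forall q, in_range q ->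
    heap s (address q) = if q \in take i R then signed q else 0;
  cell_in : tin s = encode_cells (drop i R) ++ encode_cells P;
  cell_out : tout s = header ++ nseq (n + 5 * k) 1 ++
    triples [seq spoke R o j | j <- iota 0 i] }.

Record cell_loaded (i : nat) (s : conf) : Prop := CellLoaded {
  loaded_layout : layout s;
  loaded_known : [/\ scal s 20 = 1, scal s 10 = rows + o & scal s 11 = o'];
  loaded_cell : scal s 12 = (cell_at R i).1 /\ scal s 13 = (cell_at R i).2;
  loaded_count : scal s 5 = n%:Z - i%:Z;
  loaded_vertex : scal s 16 = (i + 2)%N%:Z;
  loaded_rows : all_rows (heap s);
  loaded_table : forall q, in_range q ->
    heap s (address q) = if q \in take i R then signed q else 0;
  loaded_in : tin s = encode_cells (drop i.+1 R) ++ encode_cells P;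
  loaded_out : tout s = header ++ nseq (n + 5 * k) 1 ++
    triples [seq spoke R o j | j <- iota 0 i] }.

Definition spokes_out := header ++ nseq (n + 5 * k) 1 ++
    triples [seq spoke R o j | j <- iota 0 n].

Definition peg_addresses (j : nat) (h : int -> int) : Prop :=
  forall j', (j' < j)%N -> h (pegs + j'%:Z) = address (cell_at P j').

Record pegs_read (j : nat) (s : conf) : Prop := PegsRead {
  peg_layout : layout s;
  peg_offset : scal s 10 = rows + o;
  peg_offset' : scal s 11 = o';
  peg_count : scal s 5 = k%:Z - j%:Z;
  peg_pointer : scal s 21 = pegs + j%:Z;
  peg_rows : all_rows (heap s);
  peg_list : peg_addresses j (heap s);
  peg_table : forall q, in_range q ->
    heap s (address q) = if (q \in R) && (q \notin take j P) then signed q else 0;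
  peg_in : tin s = encode_cells (drop j P);
  peg_out : tout s = spokes_out }.

(** [j] pegs are finished and [m] slots of the next one are printed; the outer loop uses the
    invariant at [m = 0]. *)
Record slots_printed (j m : nat) (s : conf) : Prop := SlotsPrinted {
  slot_const : constants s;
  slot_peg : scal s 22 = (n + 2 + j)%N%:Z;
  slot_dead : scal s 23 = (n + 2 + k + 4 * j + m)%N%:Z;
  slot_count : scal s 5 = k%:Z - j%:Z;
  slot_pointer : scal s 21 = pegs + j%:Z;
  slot_list : peg_addresses k (heap s);
  slot_table : forall q, in_range q ->
    heap s (address q) = if free_cell R P q then signed q else 0;
  slot_out : tout s = spokes_out ++
    triples [seq slot R P o j' d | j' <- iota 0 j, d <- directions] ++
    triples [seq slot R P o j d | d <- take m directions] }.

Lemma bases : [/\ rows = 32, parities = 32 + width, pegs = 32 + width + width,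
  table = 32 + width + width + width & width = n%:Z + n%:Z + 1].
Proof. by []. Qed.

Lemma row_tables_seth c h a x : (c <= n + n + 1)%N -> pegs <= a ->
  row_tables c h -> row_tables c (seth h a x).
Proof.
have [? ? ? ? ?] := bases.
move=> cle age rt c' lt; have [e1 e2] := rt _ lt.
by rewrite /seth !ifF ?e1 ?e2 //; apply/eqP; lia.
Qed.

(* Opacity makes the rules consume a program one instruction at a time. *)
Local Opaque wp.
Ltac wp_seqs := repeat lazymatch goal with
  | |- wp (Seq _ _) _ _ => apply: wp_seq
  end.
Ltac registers := cbn [scal heap tin tout setr eqn].
Ltac by_registers := registers; lia.
Ltac wp_step := wp_seqs; lazymatch goal with
  | |- wp (Do (Const _ _)) _ _ => apply: wp_const; [exact isT|]
  | |- wp (Do (Plus _ _ _)) _ _ => apply: wp_plus; [exact isT|cbn [setr eqn]; reflexivity|]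
  | |- wp (Do (Minus _ _ _)) _ _ => apply: wp_minus; [exact isT|cbn [setr eqn]; reflexivity|]
  | |- wp (Do (Print _)) _ _ => apply: wp_print; [exact isT|cbn [setr eqn]; reflexivity|]
  | |- wp (Do (Read _)) _ _ => apply: wp_read; [exact isT|reflexivity|]
  end.
Ltac wp_steps := repeat wp_step.

Lemma print_header_correct :
  hoare (loopfree_cost print_header)
    (eq (Conf (fun=> 0) (fun=> 0) (encode_instance R P) [::]))
    print_header (capacities 0).
Proof.
apply: hoare_wp => _ <-; rewrite /print_header /encode_instance.
wp_steps; split; first split; try by_registers; rewrite -/n -/k //.
by rewrite /header cats0; registers; rewrite /=; congr [:: _, _, _, _, _ & _]; lia.
Qed.

Lemma print_capacities_correct :
  hoare ((n + 5 * k) * (loopfree_cost print_capacity).+1)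
    (capacities 0) (Repeat print_capacity 5) (capacities (n + 5 * k)).
Proof.
apply: hoare_repeat => //; first by lia.
move=> i ilt; apply: hoare_wp => -[m h inp out] [[? e1 ? ? ?] ? ? ? ? he ie oe].
cbn [scal heap tin tout] in *; rewrite /print_capacity; wp_steps.
split; last by by_registers.
split; first split; try by_registers; try by [].
by registers; rewrite oe e1 -(addn1 i) nseqD catA cats1.
Qed.

Lemma start_rows_correct :
  hoare (loopfree_cost start_rows) (capacities (n + 5 * k)) start_rows (rows_made 0).
Proof.
have [? ? ? ? ?] := bases.
apply: hoare_wp => -[m h inp out] [[? e1 ? ? ?] ? ? ? ? he ie oe].
cbn [scal heap tin tout] in *; rewrite /start_rows; wp_steps.
by split; first (split; first split); try by_registers; try by [].
Qed.

Lemma make_rows_correct :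
  hoare ((n + n + 1) * (loopfree_cost make_row).+1)
    (rows_made 0) (Repeat make_row 5) (rows_made (n + n + 1)).
Proof.
have [? ? ? ? ?] := bases.
apply: hoare_repeat => //; first by lia.
move=> c clt; apply: hoare_wp => -[m h inp out] [[[? ? ? ? ?] ? ? ? ?] ? ? e6 e7 e8 rt hb ie
  oe].
cbn [scal heap tin tout] in *; rewrite /make_row; wp_seqs.
apply: (wp_store (a := rows + c%:Z) (x := table + c%:Z * width));
  [exact isT|by_registers|lia|by_registers|].
wp_step; wp_seqs.
apply: (wp_store (a := parities + c%:Z) (x := (~~ odd c)%:Z));
  [exact isT|by_registers|lia|by_registers|].
wp_steps; split; last by by_registers.
split; first (split; first split); try by_registers; try by [].
- registers => c' lt; rewrite /seth.
  have [->|ne] := eqVneq c' c.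
    by rewrite !eqxx ifF //; apply/eqP; lia.
  have [|e1 e2] := rt c'; first by lia.
  by rewrite !ifF ?e1 ?e2 //; apply/eqP; lia.
- by registers => a age; rewrite /seth !ifF ?hb //; apply/eqP; lia.
Qed.

Lemma start_cells_correct :
  hoare (loopfree_cost start_cells) (rows_made (n + n + 1)) start_cells (cells_read 0).
Proof.
have [? ? ? ? ?] := bases.
apply: hoare_wp => -[m h inp out] [[[? ? ? ? ?] ? ? ? ?] ? ? ? ? ? rt hb ie oe].
cbn [scal heap tin tout] in *; rewrite /start_cells; wp_steps.
split; first (split; first split); try by_registers; try by [].
- by registers => q /address_ge; rewrite take0; exact: hb.
- by registers; rewrite drop0.
- by registers; rewrite /= cats0.
Qed.

Lemma read_cell_correct i : (i < n)%N ->
  hoare (loopfree_cost read_cell) (cells_read i) read_cell (cell_loaded i).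
Proof.
have [? ? ? ? ?] := bases.
move=> ilt; apply: hoare_wp => -[m h inp out] [[[? ? ? ? ?] ? ? ? ?] known ? ? rt ht ie oe].
cbn [scal heap tin tout] in *; rewrite /read_cell.
move: ie; rewrite (drop_nth (0, 0)) // => ->; rewrite -/(cell_at R i) /=.
do 2 wp_step; wp_seqs.
have {known} [[i0 ?]|[? ? ?]] :
    i = 0%N /\ m 20%N = 0 \/ [/\ m 20%N = 1, m 10%N = rows + o & m 11%N = o'].
  by case: (i) known => [|?] ?; [left|right].
- subst i.
  apply: wp_unless_do; [exact isT|by_registers|].
  wp_steps; split; first (split; first split); try by_registers; try by [].
  by split; rewrite /o /o' /origin; by_registers.
- apply: wp_unless_skip; [exact isT|by_registers|].
by split; first (split; first split); try by_registers; try by [].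
Qed.

(** Scratch contents are quantified away in the continuation, so callers need not track the
    intermediate sums. *)
Lemma wp_locate Q m h inp out (q : cell) :
  m 4%N = width -> m 10%N = rows + o -> m 11%N = o' -> m 12%N = q.1 -> m 13%N = q.2 ->
  all_rows h -> in_range q ->
  (forall x9 x15 x14 y14, Q (Conf (setr (setr (setr (setr (setr (setr m 9 x9) 15 x15)
      14 x14) 25 (even_column o q)%:Z) 14 y14) 14 (address q)) h inp out)) ->
  wp locate Q (Conf m h inp out).
Proof.
have [? ? ? ? ?] := bases.
move=> e4 e10 e11 e12 e13 rt [r1 r2] HQ; rewrite /locate.
have [|hr hp] := rt `|(q.1 + o)%R|%N; first by lia.
have absE : `|(q.1 + o)%R|%N%:Z = q.1 + o by lia.
rewrite absE in hr hp.
do 2 wp_step; wp_seqs.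
apply: (wp_fetch (a := rows + (q.1 + o)) (x := table + (q.1 + o) * width));
  [exact isT|by_registers|lia|exact: hr|].
wp_seqs; apply: (wp_fetch (a := parities + (q.1 + o)) (x := (even_column o q)%:Z));
  [exact isT|by_registers|lia|exact: hp|].
wp_step; wp_seqs; apply: (wp_plus (x := address q)); [exact isT| |exact: HQ].
by rewrite /address; by_registers.
Qed.

Lemma print_spoke_correct i : (i < n)%N ->
  hoare (loopfree_cost print_spoke) (cell_loaded i) print_spoke
    (fun s => cells_read i.+1 s /\ (0 < scal s 5) = (i.+1 < n)%N).
Proof.
have [? ? ? ? ?] := bases.
move=> ilt; apply: hoare_wp => -[m h inp out] [[[? e1 ? ? ?] ? ? ? ?] [? ? ?] [e12 e13] ? e16
  rt ht ie oe].
cbn [scal heap tin tout] in *; rewrite /print_spoke; apply: wp_seq.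
set q := cell_at R i in e12 e13.
have qR : q \in R by exact: mem_nth.
have qr := in_range_cell qR; have := address_ge qr => ?.
have qi : index q R = i by rewrite index_uniq.
apply: (wp_locate (q := q)); [by []|by []|by []|by []|by []|by []|by []|].
move=> x9 x15 x14 y14; do 3 wp_step; apply: wp_seq.
(* The tail common to both parities; the list contains the registers on which the invariant still
   relies. *)
have finish u v m' : m' 17%N = u%:Z -> m' 18%N = v%:Z -> m' 19%N = signed q ->
    m' 14%N = address q -> (forall r, r \in [:: 0; 1; 2; 3; 4; 5; 10; 11; 16; 20; 22; 23; 24;
      26]%N -> m' r = m r) ->
    spoke R o i = (u, v) ->
    wp (Print 17;; Print 18;; Print 1;; Store 14 19;; Plus 16 16 1;; Minus 5 5 1)
      (fun s => cells_read i.+1 s /\ (0 < scal s 5) = (i.+1 < n)%N) (Conf m' h inp out).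
  move=> e17 e18 e19 e14 fr spE; do 3 wp_step; wp_seqs.
  apply: (wp_store (a := address q) (x := signed q));
    [exact isT|by_registers|lia|by_registers|].
  wp_steps; split; last by registers; rewrite !fr //; lia.
  split; first (split; first split); registers; try (rewrite !fr //; lia); try by [].
  - by apply: row_tables_seth => //; lia.
  - move=> r rr; rewrite /seth (take_nth (0, 0)) // -/(cell_at R i) -/q mem_rcons inE.
    case: (eqVneq r q) => [->|ne]; first by rewrite eqxx.
    rewrite ifF ?ht //; apply: contraNF ne => /eqP /address_inj -> //.
  - by rewrite -(addn1 i) iotaD map_cat cats1 triples_rcons oe e17 e18 (fr 1%N) // e1 spE
      -!cats1 -!catA.
have spE : spoke R o i = if even_column o q then (0, i + 2)%N else (i + 2, 1)%N by [].
case ev : (even_column o q) spE => spE.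
  apply: wp_unless_skip; [exact isT|by_registers|].
  apply: finish spE; try by_registers; try by [].
    by rewrite /signed ev qi; by_registers.
  by move=> r; rewrite !inE; do 13 (case/orP; first by move=> /eqP ->); move=> /eqP ->.
apply: wp_unless_do; [exact isT|by_registers|]; do 3 wp_step.
apply: finish spE; try by_registers; try by [].
  by rewrite /signed ev qi; by_registers.
by move=> r; rewrite !inE; do 13 (case/orP; first by move=> /eqP ->); move=> /eqP ->.
Qed.

Lemma cells_correct :
  hoare (n * (loopfree_cost read_cell + loopfree_cost print_spoke).+1)
    (cells_read 0) (Repeat (read_cell;; print_spoke) 5) (cells_read n).
Proof.
apply: hoare_repeat => // i ilt.
exact: hoare_seq (read_cell_correct ilt) (print_spoke_correct ilt).
Qed.

Lemma start_pegs_correct :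
  hoare (loopfree_cost start_pegs) (cells_read n) start_pegs (pegs_read 0).
Proof.
have [? ? ? ? ?] := bases.
apply: hoare_wp => -[m h inp out] [[[? ? ? ? ?] ? ? ? ?] known ? ? rt ht ie oe].
have {known} [? ? ?] : [/\ m 20%N = 1, m 10%N = rows + o & m 11%N = o'].
  by case: (n) n_gt0 known.
cbn [scal heap tin tout] in *; rewrite /start_pegs; wp_steps.
split; first (split; first split); try by_registers; try by [].
- by registers => q qr; rewrite ht // take_size take0 andbT.
- by registers; rewrite ie drop_size drop0.
Qed.

Lemma read_peg_correct j : (j < k)%N ->
  hoare (loopfree_cost read_peg) (pegs_read j) read_peg
    (fun s => pegs_read j.+1 s /\ (0 < scal s 5) = (j.+1 < k)%N).
Proof.
have [? ? ? ? ?] := bases.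
move=> jlt; apply: hoare_wp => -[m h inp out] [[[? e1 ? ? ?] ? ? ? ?] ? ? ? ? rt lt ht ie oe].
cbn [scal heap tin tout] in *; rewrite /read_peg.
move: ie; rewrite (drop_nth (0, 0)) // => ->; rewrite -/(cell_at P j) /=.
set q := cell_at P j.
have qP : q \in P by exact: mem_nth.
have qr := in_range_cell (PR qP); have := address_ge qr => ?.
do 2 wp_step; apply: wp_seq.
apply: (wp_locate (q := q)); [by []|by []|by []|by []|by []|by []|by []|].
move=> x9 x15 x14 y14; wp_seqs.
apply: (wp_store (a := address q) (x := 0)); [exact isT|by_registers|lia|by_registers|].
wp_seqs.
apply: (wp_store (a := pegs + j%:Z) (x := address q));
  [exact isT|by_registers|lia|by_registers|].
wp_steps; split; last by by_registers.
split; first (split; first split); try by_registers; try by [].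
- by registers; do 2 (apply: row_tables_seth => //; first by lia).
- registers => j' lt'; rewrite /seth.
  have [->|ne] := eqVneq j' j; first by rewrite eqxx.
  by rewrite !ifF ?lt //; first lia; apply/eqP; lia.
- registers => r rr; have := address_ge rr => ?.
  rewrite /seth ifF; last by apply/eqP; lia.
  rewrite (take_nth (0, 0)) // -/(cell_at P j) -/q mem_rcons inE.
  case: (eqVneq r q) => [->|ne]; first by rewrite eqxx andbF.
  by rewrite ifF ?ht //; apply: contraNF ne => /eqP /address_inj ->.
Qed.

Lemma pegs_correct :
  hoare (k * (loopfree_cost read_peg).+1)
    (pegs_read 0) (Repeat read_peg 5) (pegs_read k).
Proof. exact: hoare_repeat read_peg_correct. Qed.

Lemma start_slots_correct :
  hoare (loopfree_cost start_pegs) (pegs_read k) start_pegs (slots_printed 0 0).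
Proof.
have [? ? ? ? ?] := bases.
apply: hoare_wp => -[m h inp out] [[[? ? ? ? ?] ? ? ? ?] ? ? ? ? rt lt ht ie oe].
cbn [scal heap tin tout] in *; rewrite /start_pegs; wp_steps.
split; first split; try by_registers; try by [].
- by registers => q qr; rewrite ht // take_size.
- by registers; rewrite oe /= cats0.
Qed.

Lemma print_slot_correct j r s (d := nth (true, true) directions r) :
  (j < k)%N -> (r < 4)%N -> slots_printed j r s ->
  scal s 14 = address (neighbor (cell_at P j) d) -> scal s 15 = address (cell_at P j) ->
  wp print_slot (fun s' => slots_printed j r.+1 s' /\ scal s' 15 = address (cell_at P j)) s.
Proof.
have [? ? ? ? ?] := bases.
move=> jlt rlt; case: s => m h inp out [[? e1 ? ? ?] ? ? ? ? lt ht oe] e14 e15.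
cbn [scal heap tin tout] in *; rewrite /print_slot; wp_seqs.
set q := neighbor _ d in e14.
have qr : in_range q by apply: in_range_neighbor; apply/PR/mem_nth.
have := address_ge qr => ?.
(* Slots are printed in the order of [direction_rank], so the running counter in register 23 is the
   dead end of this slot. *)
have rankE : direction_rank d = r by rewrite /d; case: (r) rlt => [|[|[|[|]]]].
apply: (wp_fetch (a := address q) (x := if free_cell R P q then signed q else 0));
  [exact isT|by_registers|lia|exact: ht|].
do 2 wp_step; apply: wp_seq.
have finish u v m' : m' 17%N = u%:Z -> m' 18%N = v%:Z ->
    (forall i, i \in [:: 0; 1; 2; 3; 4; 5; 15; 21; 22; 23]%N -> m' i = m i) ->
    slot R P o j d = (u, v) ->
    wp (Print 17;; Print 18;; Print 1;; Plus 23 23 1)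
      (fun s' => slots_printed j r.+1 s' /\ scal s' 15 = address (cell_at P j))
      (Conf m' h inp out).
  move=> e17 e18 fr slE; wp_steps; split; last by registers; rewrite fr.
  split; first split; registers; try (rewrite !fr //; lia); try by [].
  rewrite (take_nth (true, true)) // -/d map_rcons triples_rcons slE oe e17 e18 (fr 1%N) // e1.
  by rewrite -!cats1 -!catA.
have slE : slot R P o j d = if free_cell R P q then
    if even_column o q then (index q R + 2, n + 2 + j)%N else (n + 2 + j, index q R + 2)%N
  else (n + 2 + j, n + 2 + k + 4 * j + direction_rank d)%N by [].
case fr : (free_cell R P q) slE => slE; last first.
  apply: wp_unless_do; [exact isT|by_registers|]; wp_step; apply: wp_seq.
  apply: wp_unless_do; [exact isT|by_registers|]; do 2 wp_step.
  apply: finish slE; try by_registers.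
  by move=> i; rewrite !inE; do 9 (case/orP; first by move=> /eqP ->); move=> /eqP ->.
rewrite /signed; case ev : (even_column o q) slE => slE.
  apply: wp_unless_skip; [exact isT|by_registers|].
  apply: finish slE; try by_registers.
  by move=> i; rewrite !inE; do 9 (case/orP; first by move=> /eqP ->); move=> /eqP ->.
apply: wp_unless_do; [exact isT|by_registers|]; wp_step; apply: wp_seq.
apply: wp_unless_skip; [exact isT|by_registers|]; wp_step.
apply: finish slE; try by_registers.
by move=> i; rewrite !inE; do 9 (case/orP; first by move=> /eqP ->); move=> /eqP ->.
Qed.

Lemma slots_printed_set j r m h inp out x :
  slots_printed j r (Conf m h inp out) -> slots_printed j r (Conf (setr m 14 x) h inp out).
Proof. by move=> [[? ? ? ? ?] ? ? ? ? ? ? ?]; split; first split. Qed.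

Lemma print_direction_correct j r (op : instr) : (j < k)%N -> (r < 4)%N ->
  op = nth Halt [:: Plus 14 15 4; Minus 14 15 4; Plus 14 15 1; Minus 14 15 1] r ->
  hoare (loopfree_cost (op;; print_slot))
    (fun s => slots_printed j r s /\ scal s 15 = address (cell_at P j))
    (op;; print_slot)
    (fun s => slots_printed j r.+1 s /\ scal s 15 = address (cell_at P j)).
Proof.
move=> jlt rlt opE; apply: hoare_wp => -[m h inp out] [sp].
cbn [scal]; move=> e15; have [[_ e1 _ _ e4] _ _ _ _ _ _ _] := sp; cbn [scal] in e1, e4.
have nE := address_neighbor (cell_at P j) (nth (true, true) directions r).
have next x : x = address (neighbor (cell_at P j) (nth (true, true) directions r)) ->
    wp print_slot (fun s => slots_printed j r.+1 s /\ scal s 15 = address (cell_at P j))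
      (Conf (setr m 14 x) h inp out).
  move=> xE; apply: print_slot_correct => //; exact: slots_printed_set.
apply: wp_seq; case: r rlt opE {sp} nE next => [|[|[|[|//]]]] _ -> /= nE next; wp_step;
  apply: next; rewrite nE e15 ?e1 ?e4; lia.
Qed.

Lemma print_slots_correct j : (j < k)%N ->
  hoare (loopfree_cost print_slots) (slots_printed j 0) print_slots
    (fun s => slots_printed j.+1 0 s /\ (0 < scal s 5) = (j.+1 < k)%N).
Proof.
have [? ? ? ? ?] := bases; move=> jlt.
apply: (hoare_seq (B := fun s => slots_printed j 0 s /\ scal s 15 = address (cell_at P j))).
  apply: (@hoare_wp (Fetch 15 21)) => -[m h inp out] sp;
    have [[? ? ? ? ?] ? ? ? ? lt ? ?] := sp.
  cbn [scal heap tin tout] in *.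
  apply: (wp_fetch (a := pegs + j%:Z) (x := address (cell_at P j)));
    [exact isT|by_registers|lia|exact: lt|].
  by split; first (split; first split).
do 4 (apply: hoare_seq; first exact: print_direction_correct).
apply: (@hoare_wp (Plus 21 21 1;; Plus 22 22 1;; Minus 5 5 1)) => -[m h inp out].
move=> [[[? ? ? ? ?] ? ? ? ? ? ? oe] _].
cbn [scal heap tin tout] in *; wp_steps; split; last by by_registers.
split; first split; try by_registers; try by [].
registers; rewrite oe -(addn1 j) iotaD map_cat flatten_cat /triples map_cat flatten_cat /=.
by rewrite cats0 -!catA.
Qed.

Lemma slots_correct :
  hoare (k * (loopfree_cost print_slots).+1)
    (slots_printed 0 0) (Repeat print_slots 5) (slots_printed k 0).
Proof. exact: (hoare_repeat (J := fun j => slots_printed j 0)) print_slots_correct. Qed.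

Definition network_word : seq int :=
  [:: (n + 5 * k + 2)%N%:Z; (n + 4 * k)%N%:Z; 0; 1] ++ [:: n%:Z; n%:Z] ++
  nseq (n + 5 * k) 1 ++ triples (edge_list R P o).

(** The number 300 is a generous round bound: [k <= n] turns the loops over pegs into multiples of
    n, and [n > 0] absorbs the fixed costs. *)
Lemma reduction_computes :
  computes_within (rcons (compile 0 reduction) Halt) (300 * n)
    (encode_instance R P) network_word.
Proof.
apply: hoare_computes.
have total := hoare_seq print_header_correct (hoare_seq print_capacities_correct
  (hoare_seq start_rows_correct (hoare_seq make_rows_correct
  (hoare_seq start_cells_correct (hoare_seq cells_correct
  (hoare_seq start_pegs_correct (hoare_seq pegs_correct
  (hoare_seq start_slots_correct slots_correct)))))))).
move=> s /total[t [s' [tle rs sp]]]; exists t, s'; split=> //.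
  apply: leq_trans tle _; rewrite /=; lia.
rewrite (slot_out sp) /spokes_out /network_word /triples /edge_list map_cat flatten_cat.
by rewrite /= cats0 -!catA.
Qed.

End Correctness.
End Program.

Local Open Scope classical_set_scope.
Local Open Scope card_scope.

Theorem theorem1p1 :
  exists (p : seq instr) (C : nat),
    forall (n : nat) (R P : seq cell),
      (3 %| n)%N -> ptromino_instance n (n %/ 3)%N R P ->
      exists (w : seq int) (G : network),
        [/\ computes_within p (C * n)%N (encode_instance R P) w,
            encodes_network G w,
            is_flow_network G,
            max_flow_value G (n %/ 3)%N <-> (exists T : set tromino, is_pcover R P T)
          & exists N : nat,
              [set T : set tromino | is_pcover R P T] #= `I_N /\
              [set f : {ffun edge G -> nat} |
                 is_flow f /\ flow_value f = (n %/ 3)%N] #= `I_N].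
Proof.
exists (rcons (compile 0 reduction) Halt), 300 => n R P n3 [region szR uP PR szP].
have [Rn0 uR _] := region.
have nk : size R = (3 * size P)%N by rewrite szR szP mulnC divnK.
have n_gt0 : (0 < size R)%N by rewrite lt0n size_eq0.
have R0 : cell_at R 0 \in R by exact: cell_at_mem.
(* This must be the offset that the program derives from the first cell, since parities, and with
   them the edges, depend on it. *)
pose o := ((size R)%:Z - (cell_at R 0).1)%R.
exists (network_word R P), (peg_network R P o); rewrite -szP.
have [flowE countE] := @parsimonious R P o uR uP PR nk.
split=> //.
- rewrite -szR; apply: reduction_computes => //; [lia|lia|].
  by move=> q qR; exact: region_extent.
- exact: peg_network_encoding.
- exact: peg_network_is_flow_network.
Qed.
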